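(* Let $n_1,n_2,n_3,b_1,b_2,b_3,k_1,k_2$ be non-negative integers and $a$ a non-negative even integer (such that the region below is defined), and put $n=n_1+n_2+a+b_1+b_2+b_3$. Then $\operatorname{M}(S_{n_1,n_2,n_3,a,b_1,b_2,b_3,k_1,k_2,k_2})$ equals the absolute value of the determinant of the $n\times n$ matrix whose columns are indexed by $1\le j\le n$ and whose rows consist of six consecutive blocks, with entries: (1) for $1\le i\le n_2$: $(-1)^{[j\ge n_3-2k_2+1]\,b_3}\Big(\binom{i-n_1-\frac a2-b_1-k_2-1}{j-1}+((-1)^{b_1}-1)\sum_{q=n_3+\frac a2+b_3+k_1+1}^{j}\binom{i-n_1+2k_1-1}{q-1}\binom{-2k_1-\frac a2-b_1-k_2}{j-q}\Big)$; (2) for $1\le i\le n_1$: $(-1)^{[j\ge n_3+\frac a2+b_3+k_2+1]\,b_2}\binom{-n_1+n_2+n_3+\frac a2+b_2+b_3-k_2+i-1}{j-1}$; (3) for $1\le i\le b_3$: $\binom{i-1}{j-1-n_3+2k_2}$; (4) for $1\le i\le a$: $\binom{i-\frac a2-k_2-1}{j-1-n_3-b_3}$; (5) for $1\le i\le b_1$: $\binom{-\frac a2-b_1-2k_1-k_2+i-1}{j-1-n_3-\frac a2-b_3-k_1}$; (6) for $1\le i\le b_2$: $\binom{i-1}{j-1-n_3-\frac a2-b_3-k_2}$.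
   Context: Triangular lattice drawn with one family of lattice lines horizontal; $\operatorname{M}(R)$ is the number of lozenge tilings of $R$. The $(N,L)$-trapezoid is the isosceles trapezoid with horizontal longer base of length $L$ at the bottom, legs of length $N$ and lower base angles $60^\circ$; its up-pointing unit triangles lie in rows at heights $h=0,1,\dots$ (bottom row $h=0$), numbered within a row by positions $1,2,\dots$ from the left. Region $S_{n_1,n_2,n_3,a,b_1,b_2,b_3,k_1,k_2,k_3}$ (non-negative integers, $a$ even, parameters such that the holes below lie in the trapezoid and are disjoint): with $n=n_1+n_2+a+b_1+b_2+b_3$, it is obtained from the $(n,n+n_3)$-trapezoid by removing up-pointing triangles of sides $n_2,n_1,b_3,a,b_1,b_2$ whose bottom rows consist of the up-pointing unit triangles at: height $0$, positions $1,\dots,n_2$; height $0$, positions $n_2+n_3+a+b_1+b_2+b_3+1,\dots,n_1+n_2+n_3+a+b_1+b_2+b_3$; height $n_3-2k_3$, positions $n_1+\frac a2+b_1+k_3+1,\dots,n_1+\frac a2+b_1+b_3+k_3$; height $n_3+b_3$, positions $n_1+b_1+1,\dots,n_1+b_1+a$; height $n_3+\frac a2+b_3+k_1$, positions $n_1-2k_1+1,\dots,n_1-2k_1+b_1$; height $n_3+\frac a2+b_3+k_2$, positions $n_1+\frac a2+b_1+k_2+1,\dots,n_1+\frac a2+b_1+b_2+k_2$. (Geometrically: a hexagon with sides $n_1+a+B,n_3,n_2+a+B,n_1,n_3+a+B,n_2$, $B=b_1+b_2+b_3$, clockwise from the northwestern side, with a core of side $a$ and three satellites of sides $b_1,b_2,b_3$,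 all up-pointing.) Binomial coefficients: $\binom{x}{m}=x(x-1)\cdots(x-m+1)/m!$ for integers $m\ge0$ and $0$ for $m<0$. Iverson bracket: $[P]=1$ if $P$ true, $0$ otherwise. Summation convention: if $b<a$ then $\sum_{i=a}^{b}p(i)=-\sum_{i=b+1}^{a-1}p(i)$ (so $\sum_{i=a}^{a-1}p(i)=0$). *)

(* Defs.v *)
From mathcomp Require Import all_boot all_order all_algebra.
From mathcomp Require Import finmap.

Set Implicit Arguments.
Unset Strict Implicit.
Unset Printing Implicit Defensive.

Import Order.TTheory GRing.Theory Num.Theory.

Local Open Scope fset_scope.
Local Open Scope ring_scope.

(* Unit triangles of the triangular lattice: (true, h, p) is the up-pointing
   one in the row at height h, at position p; (false, h, p) is the down-pointing
   one of the same row between (true, h, p) and (true, h, p + 1).  Positions are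
   measured from a fixed lattice line of slope 60 degrees (the left leg of the
   trapezoid), so (true, h + 1, p) stands on top of (false, h, p). *)
Notation unit_triangle := (bool * int * int)%type.

Definition share_side (u d : unit_triangle) : bool :=
  let: (su, hu, pu) := u in
  let: (sd, hd, pd) := d in
  [&& su, ~~ sd &
      ((hu == hd) && ((pu == pd) || (pu == pd + 1)))
      || ((hu == hd + 1) && (pu == pd))].

Definition lozenge (R : {fset unit_triangle}) (B : {set R}) : bool :=
  [exists u : R, [exists d : R, share_side (val u) (val d) && (B == [set u; d])]].

Definition lozenge_tilings (R : {fset unit_triangle}) : {set {set {set R}}} :=
  [set P : {set {set R}} | partition P [set: R] & [forall B in P, lozenge B]].

Definition M (R : {fset unit_triangle}) : nat := #|lozenge_tilings R|.

(* The (N, L)-trapezoid translated so that its bottom left up-pointing unit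
   triangle is (true, h, p). *)
Definition trapezoid_at (h p : int) (N L : nat) : {fset unit_triangle} :=
  [fset t in [seq (true, h + r%:Z, p + q%:Z) | r <- iota 0 N, q <- iota 0 (L - r)]
          ++ [seq (false, h + r%:Z, p + q%:Z)
                 | r <- iota 0 N, q <- iota 0 (L - r).-1]].

Definition trapezoid (N L : nat) : {fset unit_triangle} := trapezoid_at 0 1 N L.

(* The up-pointing triangle of side s whose bottom row consists of the
   up-pointing unit triangles at height h and positions p, ..., p + s - 1. *)
Definition up_triangle (s : nat) (h p : int) : {fset unit_triangle} :=
  trapezoid_at h p s s.

Definition S_trapezoid (n1 n2 n3 a b1 b2 b3 : nat) : {fset unit_triangle} :=
  let n := (n1 + n2 + a + b1 + b2 + b3)%N in trapezoid n (n + n3).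

Definition S_holes (n1 n2 n3 a b1 b2 b3 k1 k2 k3 : nat) :
    seq {fset unit_triangle} :=
  let h := (a./2)%:Z in
  [:: up_triangle n2 0 1;
      up_triangle n1 0 (n2%:Z + n3%:Z + a%:Z + b1%:Z + b2%:Z + b3%:Z + 1);
      up_triangle b3 (n3%:Z - 2 * k3%:Z) (n1%:Z + h + b1%:Z + k3%:Z + 1);
      up_triangle a (n3%:Z + b3%:Z) (n1%:Z + b1%:Z + 1);
      up_triangle b1 (n3%:Z + h + b3%:Z + k1%:Z) (n1%:Z - 2 * k1%:Z + 1);
      up_triangle b2 (n3%:Z + h + b3%:Z + k2%:Z) (n1%:Z + h + b1%:Z + k2%:Z + 1)].

(* A hole of side 0 is empty, so it imposes no condition. *)
Definition S_defined (n1 n2 n3 a b1 b2 b3 k1 k2 k3 : nat) : bool :=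
  let Hs := S_holes n1 n2 n3 a b1 b2 b3 k1 k2 k3 in
  all (fun H => H `<=` S_trapezoid n1 n2 n3 a b1 b2 b3) Hs
  && pairwise (fun H H' => [disjoint H & H']) Hs.

Definition S_region (n1 n2 n3 a b1 b2 b3 k1 k2 k3 : nat) :
    {fset unit_triangle} :=
  S_trapezoid n1 n2 n3 a b1 b2 b3
  `\` \bigcup_(H <- S_holes n1 n2 n3 a b1 b2 b3 k1 k2 k3) H.

Definition binom (x m : int) : rat :=
  if m is Posz k then (\prod_(i < k) (x%:~R - i%:R)) / k`!%:R else 0.

(* Sum of p over the integers from a to b, with the convention that it is minus
   the sum over b + 1, ..., a - 1 when b < a. *)
Definition sumz (a b : int) (p : int -> rat) : rat :=
  if b < a then - \sum_(i < absz (a - 1 - b)%R) p (b + 1 + i%:Z)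
  else \sum_(i < absz (b + 1 - a)%R) p (a + i%:Z).

(* Entries of the six blocks; i and j are counted from 1. *)
Definition entry1 (n1 n3 a b1 b3 k1 k2 : nat) (i j : int) : rat :=
  let h := (a./2)%:Z in
  (-1) ^+ ((n3%:Z - 2 * k2%:Z + 1 <= j)%R * b3)%N
  * (binom (i - n1%:Z - h - b1%:Z - k2%:Z - 1) (j - 1)
     + ((-1) ^+ b1 - 1)
       * sumz (n3%:Z + h + b3%:Z + k1%:Z + 1) j (fun q =>
           binom (i - n1%:Z + 2 * k1%:Z - 1) (q - 1)
           * binom (- 2 * k1%:Z - h - b1%:Z - k2%:Z) (j - q))).

Definition entry2 (n1 n2 n3 a b2 b3 k2 : nat) (i j : int) : rat :=
  let h := (a./2)%:Z in
  (-1) ^+ ((n3%:Z + h + b3%:Z + k2%:Z + 1 <= j)%R * b2)%N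
  * binom (- n1%:Z + n2%:Z + n3%:Z + h + b2%:Z + b3%:Z - k2%:Z + i - 1) (j - 1).

Definition entry3 (n3 k2 : nat) (i j : int) : rat :=
  binom (i - 1) (j - 1 - n3%:Z + 2 * k2%:Z).

Definition entry4 (n3 a b3 k2 : nat) (i j : int) : rat :=
  binom (i - (a./2)%:Z - k2%:Z - 1) (j - 1 - n3%:Z - b3%:Z).

Definition entry5 (n3 a b1 b3 k1 k2 : nat) (i j : int) : rat :=
  let h := (a./2)%:Z in
  binom (- h - b1%:Z - 2 * k1%:Z - k2%:Z + i - 1)
        (j - 1 - n3%:Z - h - b3%:Z - k1%:Z).

Definition entry6 (n3 a b3 k2 : nat) (i j : int) : rat :=
  binom (i - 1) (j - 1 - n3%:Z - (a./2)%:Z - b3%:Z - k2%:Z).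

Definition block (m n : nat) (entry : int -> int -> rat) : 'M[rat]_(m, n) :=
  \matrix_(i < m, j < n) entry (i.+1)%:Z (j.+1)%:Z.

(* The size is n1 + n2 + a + b1 + b2 + b3, summed in the order of the blocks. *)
Definition S_matrix (n1 n2 n3 a b1 b2 b3 k1 k2 : nat) :
    'M[rat]_(n2 + (n1 + (b3 + (a + (b1 + b2))))) :=
  col_mx (block n2 _ (entry1 n1 n3 a b1 b3 k1 k2))
  (col_mx (block n1 _ (entry2 n1 n2 n3 a b2 b3 k2))
  (col_mx (block b3 _ (entry3 n3 k2))
  (col_mx (block a _ (entry4 n3 a b3 k2))
  (col_mx (block b1 _ (entry5 n3 a b1 b3 k1 k2))
          (block b2 _ (entry6 n3 a b3 k2)))))).

(* Main.v *)
(* A triangular hole can be replaced by the removal of its base, the bottom row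
   of its up-pointing unit triangles: the lozenges above the base are forced.
   Let A_h be the set of positions of the up-pointing triangles of row h that are
   holes or are matched downwards.  Row by row, a tiling is a sequence of sets
   such that A_(h+1) is the union of the holes of row h + 1 and of a set
   interlacing A_h.

   Let G_h(p, j), j = 0, 1, ..., vanish for j < h, have a value e_h = +-1
   independent of p for j = h, and satisfy
     G_h(p+1, j) - G_h(p, j) = s_(h+1)(p) G_(h+1)(p, j)   (h < j),
   where s_(h+1)(p) is the product of (-1)^b over the holes of side b whose base is
   in row h + 1 and starts at or before p.  Consider the determinant, over the
   columns j >= h, of the rows G_h(p, _) for p in A_h and G_h'(p, _) for (h', p) in
   the base of a hole above row h.  Subtracting consecutive rows and expanding by
   multilinearity turns it into the sum, over the interlacing sets, of the same
   determinants for row h + 1; the sign of sorting the base of a hole into an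
   interlacing set is exactly the product of the s_(h+1).  Hence the number of
   tilings is, up to sign, the determinant of the rows of G at the bases.

   Without signs, G_h(p, j) = binom(p + const, j - h).  The satellites of odd side
   are the origins of two cuts, the lattice line through the left edges of the
   satellites of sides b2 and b3 (these are aligned since k3 = k2) and the one
   through the left edge of the satellite of side b1; multiplying by a sign the
   coefficients of the Newton expansion along a cut gives the entries of the six
   blocks. *)

Require Import Defs.
From mathcomp Require Import all_boot all_order all_algebra.
From mathcomp Require Import finmap.
From mathcomp Require Import zify ring.

Set Implicit Arguments.
Unset Strict Implicit.
Unset Printing Implicit Defensive.

Import Order.TTheory GRing.Theory Num.Theory.

Local Open Scope fset_scope.
Local Open Scope ring_scope.

(** * Removing a lozenge from a region *)

Definition adjacent (t u : unit_triangle) := share_side t u || share_side u t.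

Lemma adjacentC t u : adjacent t u = adjacent u t.
Proof. by rewrite /adjacent orbC. Qed.

Lemma adjacentxx t : adjacent t t = false.
Proof. by case: t => [[[] h] p]; rewrite /adjacent /=. Qed.

Lemma lozengeP (R : {fset unit_triangle}) (B : {set R}) :
  reflect (exists t u : R, adjacent (val t) (val u) /\ B = [set t; u]) (lozenge B).
Proof.
apply: (iffP existsP) => [[u /existsP[d /andP[ud /eqP->]]]|[t [u [/orP[tu|ut] ->]]]].
- by exists u, d; rewrite /adjacent ud.
- by exists t; apply/existsP; exists u; rewrite tu eqxx.
- by exists u; apply/existsP; exists t; rewrite ut setUC eqxx.
Qed.

Lemma lozenge_pair (R : {fset unit_triangle}) (t u : R) :
  lozenge [set t; u] = adjacent (val t) (val u).
Proof.
apply/lozengeP/idP => [[t' [u' [adj /setP eq2]]]|adj]; last by exists t, u.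
have := eq2 t; have := eq2 u; have := eq2 t'; have := eq2 u'.
rewrite !inE !eqxx !orbT /= => /orP[]/eqP eu /orP[]/eqP et; subst t' u'.
- by rewrite adjacentxx in adj.
- by rewrite adjacentC.
- by [].
- by rewrite adjacentxx in adj.
Qed.

(** Deleting the block [[set t; u]] from a tiling leaves a tiling of the smaller region. Blocks are
    sets over the finite type of the region, so they are transported along the inclusion [fincl],
    which preserves lozenges. *)
Lemma card_tilings_with_lozenge (R : {fset unit_triangle}) (t u : R) :
    adjacent (val t) (val u) ->
  #|[set P in lozenge_tilings R | [set t; u] \in P]| = M (R `\ val t `\ val u).
Proof.
move=> adj; set B0 := [set t; u]; set R' := R `\ val t `\ val u.
have sR : R' `<=` R by apply/fsubsetP => x; rewrite !inE => /and3P[].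
pose f := fincl sR; have f_inj : injective f by exact: fincl_inj.
have fT : f @: [set: R'] = [set: R] :\: B0.
  apply/setP => x; rewrite !inE andbT; apply/imsetP/idP => [[y _ ->]|].
    have := valP y; rewrite !inE -!val_eqE /= => /and3P[/negPf-> /negPf->] _.
    by [].
  rewrite negb_or => /andP[xt xu].
  have xR' : val x \in R' by rewrite !inE !(inj_eq val_inj) xt xu (valP x).
  by exists [` xR'] => //; apply: val_inj.
have floz (B : {set R'}) : lozenge (f @: B) = lozenge B.
  apply/lozengeP/lozengeP => -[x [y [adj_xy eB]]].
    have : x \in f @: B by rewrite eB !inE eqxx.
    have : y \in f @: B by rewrite eB !inE eqxx orbT.
    move=> /imsetP[y' _ ey] /imsetP[x' _ ex]; exists x', y'.
    rewrite ex ey in adj_xy eB; split => //.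
    by apply: (imset_inj f_inj); rewrite eB imsetU !imset_set1.
  by exists (f x), (f y); rewrite eB imsetU !imset_set1.
pose F (Q : {set {set R'}}) := B0 |: [set f @: (B : {set R'}) | B in Q].
have B0F (Q : {set {set R'}}) : B0 \notin [set f @: (B : {set R'}) | B in Q].
  apply/imsetP => -[B _ /setP/(_ t)]; rewrite !inE eqxx /= => /esym/imsetP[x _].
  move=> et; have : t \in f @: [set: R'] by rewrite et imset_f.
  by rewrite fT !inE eqxx.
suff -> : [set P in lozenge_tilings R | B0 \in P] = F @: lozenge_tilings R'.
  rewrite card_imset // => Q1 Q2 /(congr1 (fun X => X :\ B0)).
  by rewrite /F !setU1K //; apply/imset_inj/imset_inj.
apply/setP => P; rewrite !inE; apply/idP/imsetP; last first.
  case=> Q; rewrite inE => /andP[pQ /forall_inP lQ] ->.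
  rewrite setU11 andbT; apply/andP; split.
    have -> : [set: R] = B0 :|: ([set: R] :\: B0).
      by apply/setP => x; rewrite !inE andbT orbN.
    apply: partitionU1; first by rewrite -fT imset_partition.
      by apply/set0Pn; exists t; rewrite !inE eqxx.
    by rewrite disjoint_sym disjoints_subset subsetDr.
  apply/forall_inP => B /setU1P[->|/imsetP[B' /lQ lB' ->]].
    by rewrite lozenge_pair.
  by rewrite floz.
case/andP => /andP[pP /forall_inP lP] B0P.
have := partitionD1 pP B0P; set P' := P :\ B0; rewrite -fT => pP'.
pose Q := [set f @^-1: (B : {set R}) | B in P'].
have P'K B : B \in P' -> f @: (f @^-1: B) = B.
  move=> BP'; apply/setP => x; apply/imsetP/idP => [[y + ->]|xB].
    by rewrite inE.
  have := subsetP (partitionS pP' BP') x xB => /imsetP[y _ ey].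
  by exists y; rewrite // inE -ey.
have fQ : [set f @: (B : {set R'}) | B in Q] = P'.
  apply/setP => B; apply/imsetP/idP => [[_ /imsetP[C CP' ->] ->]|BP'].
    by rewrite P'K.
  by exists (f @^-1: B); rewrite ?imset_f ?P'K.
exists Q; last by rewrite /F fQ setD1K.
rewrite inE; apply/andP; split.
  by move: pP'; rewrite -fQ imset_partition.
apply/forall_inP => B BQ; rewrite -floz; apply: lP.
suff: f @: B \in P' by rewrite inE => /andP[].
by rewrite -fQ imset_f.
Qed.

(** Each tiling matches [t] with exactly one neighbour, the other cell of its block; tilings are
    classified by it. The list [us] enumerates the neighbours in the whole lattice. *)
Lemma M_rec (R : {fset unit_triangle}) (t : unit_triangle)
    (us : seq unit_triangle) : t \in R -> uniq us ->
    (forall u, (u \in us) = adjacent t u) ->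
  M R = (\sum_(u <- us | u \in R) M (R `\ t `\ u))%N.
Proof.
move=> tR us_uniq usE; pose t' : R := [` tR].
transitivity (\sum_(u : R | adjacent t (val u)) M (R `\ t `\ val u))%N; last first.
  rewrite -(big_seq_fsetE _ _ (fun u => adjacent t u) (fun u => M (R `\ t `\ u))) /=.
  rewrite -[LHS]big_filter -[RHS]big_filter; apply: perm_big.
  apply: uniq_perm; rewrite ?filter_uniq ?fset_uniq // => u.
  by rewrite !mem_filter usE andbC.
transitivity (\sum_(u : R | adjacent t (val u))
    \sum_(P in lozenge_tilings R | [set t'; u] \in P) 1)%N; last first.
  apply: eq_bigr => u adj_tu.
  rewrite -(@card_tilings_with_lozenge R t' u adj_tu) -sum1_card.
  by apply: eq_bigl => P; rewrite !inE.
rewrite (exchange_big_dep (mem (lozenge_tilings R))) /=; last by move=> u P _ /andP[].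
rewrite /M -sum1_card; apply: eq_bigr => P; rewrite inE => /andP[pP /forall_inP lP].
have tcov : t' \in cover P by rewrite (cover_partition pP) inE.
have BP := pblock_mem tcov.
have tB : t' \in pblock P t' by rewrite mem_pblock.
have [u [adj_tu eB]] : exists u, adjacent t (val u) /\ pblock P t' = [set t'; u].
  have /lozengeP[x [y [adj eB]]] := lP _ BP.
  move: tB; rewrite eB => /set2P[e|e].
    by exists y; rewrite -[t]/(val t') e.
  by exists x; rewrite -[t]/(val t') e adjacentC; split=> //; rewrite setUC.
rewrite (big_pred1 u) // => v /=.
have Pt : P \in lozenge_tilings R by rewrite inE pP; apply/forall_inP.
move: Pt; rewrite inE => ->; rewrite /=; apply/andP/eqP => [[adj_tv vP]|->];
  last by rewrite -eB adj_tu.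
have tv : t' \in [set t'; v] by rewrite !inE eqxx.
have := def_pblock (partition_trivIset pP) vP tv.
rewrite eB => /setP/(_ v); rewrite !inE eqxx orbT => /orP[/eqP ev|/eqP//].
by rewrite ev adjacentxx in adj_tv.
Qed.

Lemma M_fset0 : M fset0 = 1%N.
Proof.
rewrite /M; apply/eqP/cards1P; exists set0; apply/setP => P; rewrite !inE.
have -> : [set: fset0] = set0 :> {set (fset0 : {fset unit_triangle})}.
  by apply/setP => -[x xP]; exfalso; move: (xP); rewrite inE.
rewrite partition_set0; case: eqP => //= ->.
by apply/forall_inP => B; rewrite inE.
Qed.

(** * Regions given by boolean predicates on natural coordinates *)

Definition in_trapezoid (N L : nat) (s : bool) (h p : nat) : bool :=
  [&& h < N, 0 < p & p + h + ~~ s <= L]%N.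

Lemma mem_trapezoid_at (h p : int) (N L : nat) (t : unit_triangle) :
  (t \in trapezoid_at h p N L) =
  [&& h <= t.1.2, t.1.2 < h + N%:Z, p <= t.2 &
      (t.1.2 - h) + (t.2 - p) + (~~ t.1.1)%:Z < L%:Z].
Proof.
rewrite /trapezoid_at !inE; case: t => [[s h'] p'] /=.
apply/orP/and4P => [[|]|[h1 h2 h3 h4]].
- move=> /allpairsPdep[r [q [+ + [-> -> ->]]]]; rewrite !mem_iota => rN qL.
  by split; lia.
- move=> /allpairsPdep[r [q [+ + [-> -> ->]]]]; rewrite !mem_iota => rN qL.
  by split=> /=; lia.
case: s h4 => /= h4; [left|right]; apply/allpairsPdep;
  exists `|h' - h|%N, `|p' - p|%N; split; rewrite ?mem_iota; try lia;
  by congr (_, _, _); lia.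
Qed.

Definition subregion (N L : nat) (P : bool -> nat -> nat -> bool) : {fset unit_triangle} :=
  [fset t in trapezoid N L | P t.1.1 `|t.1.2|%N `|t.2|%N].

Lemma in_subregion N L P (s : bool) (h p : nat) :
  ((s, h%:Z, p%:Z) \in subregion N L P) = in_trapezoid N L s h p && P s h p.
Proof.
by rewrite in_fset inE /= mem_trapezoid_at /in_trapezoid /=; congr (_ && _); lia.
Qed.

Lemma subregionP N L P (t : unit_triangle) : t \in subregion N L P ->
  exists s h p, t = (s, h%:Z, p%:Z) :> unit_triangle.
Proof.
rewrite in_fset inE mem_trapezoid_at => /andP[/and4P[h1 h2 h3 h4] _].
case: t h1 h2 h3 h4 => [[s h] p] /= h1 h2 h3 h4.
by exists s, `|h|%N, `|p|%N; congr (_, _, _); lia.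
Qed.

Lemma eq_fset_subregion N L P (R : {fset unit_triangle}) :
    (forall t, t \in R -> exists s h p, t = (s, h%:Z, p%:Z) :> unit_triangle) ->
    (forall s (h p : nat), ((s, h%:Z, p%:Z) \in R) = in_trapezoid N L s h p && P s h p) ->
  R = subregion N L P.
Proof.
move=> RP RE; apply/fsetP => t; apply/idP/idP => tP.
  by have [s [h [p et]]] := RP t tP; move: tP; rewrite et RE in_subregion.
by have [s [h [p et]]] := subregionP tP; move: tP; rewrite et RE in_subregion.
Qed.

Definition region_count N L P := M (subregion N L P).

Definition drop_at (P : bool -> nat -> nat -> bool) (s0 : bool) (h0 p0 : nat) :=
  fun s h p => P s h p && ~~ [&& s == s0, h == h0 & p == p0].

Lemma eq_region_count N L P Q :
    (forall s h p, in_trapezoid N L s h p -> P s h p = Q s h p) ->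
  region_count N L P = region_count N L Q.
Proof.
move=> PQ; congr M; apply: eq_fset_subregion => [t|s h p]; first exact: subregionP.
by rewrite in_subregion; apply: andb_id2l => /PQ.
Qed.

Lemma subregionD1 N L P s0 h0 p0 :
  subregion N L P `\ (s0, h0%:Z, p0%:Z) = subregion N L (drop_at P s0 h0 p0).
Proof.
apply: eq_fset_subregion => [t|s h p]; first by rewrite in_fsetD1 => /andP[_ /subregionP].
rewrite in_fsetD1 in_subregion /drop_at !xpair_eqE !eqz_nat -!andbA.
by rewrite andbC -!andbA.
Qed.

Lemma region_count_down N L (P : bool -> nat -> nat -> bool) h p :
    in_trapezoid N L false h p -> P false h p ->
  region_count N L P =
   (P true h p * region_count N L (drop_at (drop_at P false h p) true h p)
  + P true h p.+1 * region_count N L (drop_at (drop_at P false h p) true h p.+1)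
  + (in_trapezoid N L true h.+1 p && P true h.+1 p) *
       region_count N L (drop_at (drop_at P false h p) true h.+1 p))%N.
Proof.
move=> hp_in Php; rewrite /region_count.
rewrite (@M_rec _ (false, h%:Z, p%:Z)
  [:: (true, h%:Z, p%:Z); (true, h%:Z, p.+1%:Z); (true, h.+1%:Z, p%:Z)]).
- rewrite !big_cons big_nil !in_subregion !subregionD1.
  have -> : in_trapezoid N L true h p by move: hp_in; rewrite /in_trapezoid; lia.
  have -> : in_trapezoid N L true h p.+1 by move: hp_in; rewrite /in_trapezoid; lia.
  by rewrite !andTb; case: (P true h p); case: (P true h p.+1); case: (_ && _);
    rewrite /= ?(mul1n, mul0n, addn0, add0n, addnA).
- by rewrite in_subregion hp_in.
- by rewrite /= !inE !xpair_eqE; lia.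
move=> [[[] h'] p']; rewrite /adjacent /= !inE !xpair_eqE /=; lia.
Qed.

(** The last two hypotheses remove the lower and the left neighbour, so the only possible partner is
    the right one. *)
Lemma region_count_up N L (P : bool -> nat -> nat -> bool) h p :
    in_trapezoid N L true h p -> P true h p ->
    (forall h', h = h'.+1 -> P false h' p = false) ->
    (forall p', p = p'.+1 -> P false h p' = false) ->
  region_count N L P = ((in_trapezoid N L false h p && P false h p) *
     region_count N L (drop_at (drop_at P true h p) false h p))%N.
Proof.
move=> hp_in Php Ph Pp; rewrite /region_count.
rewrite (@M_rec _ (true, h%:Z, p%:Z)
  [:: (false, h%:Z, p%:Z); (false, h%:Z, p%:Z - 1); (false, h%:Z - 1, p%:Z)]).
- rewrite !big_cons big_nil !in_subregion !subregionD1.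
  have -> : ((false, h%:Z, p%:Z - 1) \in subregion N L P) = false.
    case: p Pp {hp_in Php Ph} => [_|p Pp].
      by apply/negP => /subregionP[? [? [? []]]]; lia.
    by rewrite intS addrC addKr in_subregion Pp ?andbF.
  have -> : ((false, h%:Z - 1, p%:Z) \in subregion N L P) = false.
    case: h Ph {hp_in Php Pp} => [_|h Ph].
      by apply/negP => /subregionP[? [? [? []]]]; lia.
    by rewrite intS addrC addKr in_subregion Ph ?andbF.
  by case: (_ && _); rewrite /= ?(mul1n, mul0n, addn0).
- by rewrite in_subregion hp_in.
- by rewrite /= !inE !xpair_eqE; lia.
move=> [[[] h'] p']; rewrite /adjacent /= !inE !xpair_eqE /=; lia.
Qed.

Local Open Scope nat_scope.

(** * Tilings row by row *)

(* The rows of height at least h, without the up-pointing units of [us] and without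
   those of row h at the positions of [A]. *)
Definition rows_above (us : seq (nat * nat)) (h : nat) (A : seq nat) :=
  fun (s : bool) (h' p : nat) =>
  (h <= h') && (s ==> ((h', p) \notin us) && ~~ ((h' == h) && (p \in A))).

(* What remains when row h is filled from the left up to position q, with [C] the
   positions of row h + 1 already taken from below: the next triangle to match is
   the up-pointing one at q if b = false, the down-pointing one at q if b = true. *)
Definition row_rest us (h : nat) (b : bool) (q : nat) (A C : seq nat) :=
  fun (s : bool) (h' p : nat) =>
  if h' == h then if s then (q + b <= p) && (p \notin A) else q <= p
  else rows_above us h.+1 C s h' p.

(** Between consecutive removed positions [x < y] a row has the down-pointing units [x, ..., y - 1],
    one more than the up-pointing units left there. Exactly one of them is matched upwards, to the
    same position of the next row; hence the half-open ranges. *)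
Fixpoint interlacing (x : nat) (s : seq nat) : seq (seq nat) :=
  if s is y :: s' then [seq p :: t | p <- index_iota x y, t <- interlacing y s']
  else [:: [::]].

Section RowTransfer.
Variables (N L : nat) (us : seq (nat * nat)) (h : nat).
Hypothesis hN : h < N.

Let rc b q A C := region_count N L (row_rest us h b q A C).

Definition available (p : nat) := (h.+1 < N) && ((h.+1, p) \notin us).

Lemma row_rest_up q A C : 0 < q -> q + h <= L -> q \notin A ->
  rc false q A C = (q + h < L) * rc false q.+1 A C.
Proof.
move=> q0 qL qA; rewrite /rc (@region_count_up N L _ h q).
- have -> : in_trapezoid N L false h q = (q + h < L).
    by rewrite /in_trapezoid hN q0 /= addn1.
  rewrite /row_rest eqxx leqnn andbT; congr (_ * _); apply: eq_region_count => s h' p _.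
  rewrite /drop_at /row_rest; case: (eqVneq h' h) => [_|_] /=; last first.
    by rewrite !andbF !andbT.
  rewrite addn0 addn0; case: s => /=; last by rewrite andbT; lia.
  by rewrite andbT; case: (p \in A); lia.
- by rewrite /in_trapezoid hN q0 /=; lia.
- by rewrite /row_rest eqxx addn0 leqnn.
- move=> h' eh; rewrite /row_rest /rows_above.
  by have [-> ->] : (h' == h) = false /\ (h < h') = false by lia.
- by move=> p' ep; rewrite /row_rest eqxx; lia.
Qed.

(** Forced matchings to the right run to the end of the row, where the last up-pointing unit has no
    partner. *)
Lemma row_rest_up_nil q C : 0 < q -> q + h <= L -> rc false q [::] C = 0.
Proof.
move=> + qL; have [k] := ubnP (L - h - q); elim: k q qL => // k IH q qL kq q0.
rewrite row_rest_up //; case: (ltnP (q + h) L) => // qL'.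
by rewrite mul1n IH //; lia.
Qed.

Lemma row_rest_up_cons q y A C : 0 < q -> q <= y -> y + h <= L ->
  path ltn y A -> rc false q (y :: A) C = rc true y A C.
Proof.
move=> + + yL yA; have [k] := ubnP (y - q); elim: k q => // k IH q kq q0 qy.
have [eqy|q_y] := eqVneq q y.
  apply: eq_region_count => s h' p _; rewrite /row_rest eqy inE addn0 addn1.
  by case: eqP => // _; case: s => //; case: (p \in A); lia.
have [qy' qL] : q < y /\ q + h < L by lia.
rewrite row_rest_up ?qL ?mul1n ?IH //; try lia.
rewrite inE negb_or q_y; apply/negP => qA.
by have := allP (order_path_min ltn_trans yA) q qA => /=; lia.
Qed.

(** The left neighbour is already used, so the right neighbour and the unit on top remain. The
    condition on [C] ensures that the latter has not yet been taken from below. *)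
Lemma row_rest_down q A C : 0 < q -> q + h < L -> all (gtn q) C ->
  rc true q A C = (q.+1 \notin A) * rc true q.+1 A C
                  + available q * rc false q.+1 A (q :: C).
Proof.
move=> q0 qL Cq; rewrite /rc (@region_count_down N L _ h q); last 2 first.
- by rewrite /in_trapezoid hN q0 /=; lia.
- by rewrite /row_rest eqxx.
have -> : row_rest us h true q A C true h q = false.
  by rewrite /row_rest eqxx; case: (q \in A); lia.
have -> : row_rest us h true q A C true h q.+1 = (q.+1 \notin A).
  by rewrite /row_rest eqxx addn1 leqnn.
have -> : in_trapezoid N L true h.+1 q && row_rest us h true q A C true h.+1 q
          = available q.
  rewrite /in_trapezoid /row_rest /rows_above /available q0 /=; case: (_ < N) => //=.
  have -> : q \in C = false by apply/negP => /(allP Cq) /=; rewrite ltnn.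
  have -> : q + h.+1 + 0 <= L by lia.
  have -> : h.+1 == h = false by lia. by rewrite leqnn !andbF /= ?andbT.
rewrite -[nat_of_bool false]/0 mul0n add0n; congr (_ + _).
  case: (boolP (q.+1 \in A)) => q1A; rewrite ?mul0n // !mul1n.
  apply: eq_region_count => s h' p _.
  rewrite /drop_at /row_rest; case: (eqVneq h' h) => [_|_] /=; last first.
    by rewrite !andbF !andbT.
  by case: s => /=; case: (p \in A); lia.
congr (_ * _); apply: eq_region_count => s h' p _.
rewrite /drop_at /row_rest /rows_above inE; case: (eqVneq h' h) => [_|h'h] /=.
  by case: s => /=; case: (p \in A); lia.
by case: s => /=; case: (p \in C); case: ((h', p) \in us); lia.
Qed.

(** An upward match after the last removed position would leave an up-pointing unit without partner,
    so all matches go to the right. *)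
Lemma row_rest_down_last q C : 0 < q -> q + h <= L -> all (gtn q) C ->
  rc true q [::] C = region_count N L (rows_above us h.+1 C).
Proof.
have [k] := ubnP (L - h - q); elim: k q => // k IH q kq q0 qL Cq.
have [qL'|Lq] := ltnP (q + h) L.
  rewrite row_rest_down // row_rest_up_nil //.
  rewrite muln0 addn0 mul1n IH //; try lia.
  by apply/allP => c /(allP Cq) /=; lia.
apply: eq_region_count => s h' p; rewrite /in_trapezoid /row_rest /rows_above => p_in.
case: (eqVneq h' h) p_in => [->|_] //; case: s => /=; lia.
Qed.

Lemma row_rest_down_cons q y A C : 0 < q -> q < y -> y + h <= L ->
    path ltn y A -> all (gtn q) C ->
  rc true q (y :: A) C =
  \sum_(p <- index_iota q y | available p) rc true y A (p :: C).
Proof.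
move=> + + yL yA; have [k] := ubnP (y - q); elim: k q => // k IH q kq q0 qy Cq.
rewrite row_rest_down //; last by lia.
rewrite row_rest_up_cons //.
rewrite -[index_iota q y]/(iota q _) (_ : y - q = (y - q.+1).+1) /=; last by lia.
rewrite big_cons -/(index_iota q.+1 y) inE negb_or.
have -> : (if available q then rc true y A (q :: C) +
    \sum_(p <- index_iota q.+1 y | available p) rc true y A (p :: C) else
    \sum_(p <- index_iota q.+1 y | available p) rc true y A (p :: C)) =
    \sum_(p <- index_iota q.+1 y | available p) rc true y A (p :: C)
    + available q * rc true y A (q :: C).
  by case: available; rewrite ?mul1n ?mul0n ?addn0 // addnC.
congr (_ + _); have [eqy|q1y] := eqVneq q.+1 y.
  by rewrite eqy /index_iota subnn big_nil mul0n.
rewrite IH //; try lia; last by apply/allP => c /(allP Cq) /=; lia.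
have -> : q.+1 \notin A; last by rewrite mul1n.
apply/negP => qA.
by have := allP (order_path_min ltn_trans yA) q.+1 qA => /=; lia.
Qed.

Lemma row_rest_interlacing q A C : 0 < q -> path ltn q A ->
    all (fun p => p + h <= L) (q :: A) -> all (gtn q) C ->
  rc true q A C = \sum_(t <- interlacing q A | all available t)
                   region_count N L (rows_above us h.+1 (t ++ C)).
Proof.
elim: A q C => [|y A IH] q C q0 /=.
  move=> _ /andP[qL _] Cq; rewrite row_rest_down_last //.
  by rewrite big_cons big_nil /= addn0.
move=> /andP[qy yA] /and3P[qL yL AL] Cq.
rewrite row_rest_down_cons // [RHS]big_mkcond big_allpairs_dep [LHS]big_mkcond /=.
apply: eq_big_seq => p; rewrite mem_index_iota => /andP[qp py]; rewrite -big_mkcond.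
case: ifP => av; last by rewrite big_pred0 // => t; rewrite av.
rewrite IH //=; first last.
- by rewrite py; apply/allP => c /(allP Cq) /=; lia.
- by rewrite yL AL.
- by lia.
apply: eq_bigr => t _; apply: eq_region_count => s h' p' _.
rewrite /rows_above !(mem_cat, inE).
by case: (p' \in t); case: (p' \in C); rewrite ?orbT ?orbF.
Qed.

Hypothesis us_above : all (fun u => h < u.1) us.

Lemma rows_above_row_rest A :
  region_count N L (rows_above us h A) = rc false 1 A [::].
Proof.
apply: eq_region_count => s h' p /and3P[_ p0 _].
rewrite /row_rest /rows_above in_nil addn0 p0 andbF andbT /=.
case: (eqVneq h' h) => [->|h'h] /=; last by rewrite andbT ltn_neqAle eq_sym h'h.
rewrite leqnn; case: s => //=; case: (boolP (_ \in us)) => //= hp.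
by have := allP us_above _ hp; rewrite ltnn.
Qed.

Lemma row_transfer_nil : h < L -> region_count N L (rows_above us h [::]) = 0.
Proof. by move=> hL; rewrite rows_above_row_rest row_rest_up_nil. Qed.

Lemma row_transfer x A : path ltn x A ->
    all (fun p => (0 < p) && (p + h <= L)) (x :: A) ->
  region_count N L (rows_above us h (x :: A)) =
  \sum_(t <- interlacing x A | all available t)
    region_count N L (rows_above us h.+1 t).
Proof.
move=> xA /= /andP[/andP[x0 xL] AL]; rewrite rows_above_row_rest.
rewrite row_rest_up_cons // row_rest_interlacing //=.
  by under eq_bigr do rewrite cats0.
by rewrite xL; apply: sub_all AL => p /andP[].
Qed.

End RowTransfer.

(** * Forced lozenges in triangular holes *)

Definition in_triangle (t : nat * nat * nat) (s : bool) (h p : nat) : bool :=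
  let: (h0, p0, b) := t in
  [&& h0 <= h, p0 <= p & (h - h0) + (p - p0) + ~~ s < b].

Definition in_base (t : nat * nat * nat) (s : bool) (h p : nat) : bool :=
  let: (h0, p0, b) := t in [&& s, h == h0, p0 <= p & p < p0 + b].

Definition carve (P Q : bool -> nat -> nat -> bool) :=
  fun s h p => P s h p && ~~ Q s h p.

(** The down-pointing unit at [p0 + k] sits between two removed base units, so it is matched
    upwards. In the carved predicate, [h0 + s] is the row of either half of such a lozenge. *)
Lemma region_count_row N L P h0 p0 b k : k < b ->
    (forall s h p, in_triangle (h0, p0, b) s h p -> in_trapezoid N L s h p && P s h p) ->
  region_count N L (carve P (in_base (h0, p0, b))) =
  region_count N L (carve (carve P (in_base (h0, p0, b))) (fun s h p =>
    (h == h0 + s) && (p0 <= p < p0 + k))).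
Proof.
move=> + PT; elim: k => [_|k IH kb].
  apply: eq_region_count => s h p _; rewrite /carve.
  have -> : (p0 <= p < p0 + 0) = false by lia.
  by rewrite andbF andbT.
rewrite IH; last by lia.
have /andP[dn_in dnP] : in_trapezoid N L false h0 (p0 + k) && P false h0 (p0 + k).
  by apply: PT; rewrite /in_triangle; lia.
have /andP[up_in upP] : in_trapezoid N L true h0.+1 (p0 + k) && P true h0.+1 (p0 + k).
  by apply: PT; rewrite /in_triangle; lia.
rewrite (region_count_down dn_in); last first.
  by rewrite /carve /in_base dnP /=; lia.
have -> : carve (carve P (in_base (h0, p0, b)))
  (fun (s : bool) h p => (h == h0 + s) && (p0 <= p < p0 + k)) true h0 (p0 + k) = false.
  by rewrite /carve /in_base; case: (P true h0 _) => //=; lia.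
have -> : carve (carve P (in_base (h0, p0, b)))
  (fun (s : bool) h p => (h == h0 + s) && (p0 <= p < p0 + k)) true h0 (p0 + k).+1 = false.
  by rewrite /carve /in_base; case: (P true h0 _) => //=; lia.
have -> : carve (carve P (in_base (h0, p0, b)))
  (fun (s : bool) h p => (h == h0 + s) && (p0 <= p < p0 + k)) true h0.+1 (p0 + k) = true.
  by rewrite /carve /in_base upP /=; lia.
rewrite up_in -[nat_of_bool false]/0 !mul0n !add0n mul1n.
apply: eq_region_count => s h p _; rewrite /drop_at /carve /in_base.
by case: (P s h p); case: s => //=; lia.
Qed.

(** The forced lozenges over a base of side [b.+1] remove the base of a triangle of side [b] from
    the next row, and induction on the side applies. *)
Lemma region_count_triangle N L P (t : nat * nat * nat) :
    (forall s h p, in_triangle t s h p -> in_trapezoid N L s h p && P s h p) ->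
  region_count N L (carve P (in_base t)) = region_count N L (carve P (in_triangle t)).
Proof.
case: t => -[h0 p0] b; elim: b h0 P => [|b IH] h0 P PT.
  apply: eq_region_count => s h p _; rewrite /carve /in_base /in_triangle.
  by case: (P s h p) => //; lia.
rewrite (@region_count_row _ _ _ _ _ _ b) //.
pose P' := carve P (fun s h p => (h == h0) && in_triangle (h0, p0, b.+1) s h p).
transitivity (region_count N L (carve P' (in_base (h0.+1, p0, b)))).
  apply: eq_region_count => s h p _; rewrite /P' /carve /in_base /in_triangle.
  by case: (P s h p); case: s => //=; lia.
rewrite IH.
  apply: eq_region_count => s h p _; rewrite /P' /carve /in_triangle.
  by case: (P s h p) => //=; lia.
move=> s h p hT; rewrite /P' /carve andbA PT /=.
  by move: hT; rewrite /in_triangle; lia.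
by move: hT; rewrite /in_triangle; lia.
Qed.

Definition triangle_cells (t : nat * nat * nat) : seq (nat * nat) :=
  [seq (t.1.1, p) | p <- iota t.1.2 t.2].

Lemma mem_triangle_cells t h p :
  ((h, p) \in triangle_cells t) = in_base t true h p.
Proof.
case: t => -[h0 p0] b; rewrite /triangle_cells /in_base /=.
apply/mapP/idP => [[q + [-> ->]]|/and3P[/eqP-> ? ?]]; first by rewrite mem_iota eqxx.
by exists p; rewrite // mem_iota; lia.
Qed.

Lemma base_in_triangle t h p : in_base t true h p -> in_triangle t true h p.
Proof. by case: t => -[h0 p0] b; rewrite /in_base /in_triangle /=; lia. Qed.

(** The holes are filled one at a time; disjointness keeps the cells of one intact while the others
    are carved. *)
Lemma region_count_triangles N L (r : rel (nat * nat * nat)) ts P :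
    (forall t u s h p, r t u -> in_triangle t s h p -> ~~ in_triangle u s h p) ->
    (forall t s h p, t \in ts -> in_triangle t s h p ->
       in_trapezoid N L s h p && P s h p) ->
    pairwise r ts ->
  region_count N L (carve P (fun s h p =>
     s && ((h, p) \in flatten [seq triangle_cells t | t <- ts]))) =
  region_count N L (carve P (fun s h p => has (fun t => in_triangle t s h p) ts)).
Proof.
move=> rP; elim: ts P => [|t ts IH] P tsP /=.
  by move=> _; apply: eq_region_count => s h p _; rewrite /carve in_nil andbF.
move=> /andP[/allP rt rts].
pose F s h p := s && ((h, p) \in flatten [seq triangle_cells t | t <- ts]).
transitivity (region_count N L (carve (carve P F) (in_base t))).
  apply: eq_region_count => s h p _; rewrite /carve /F mem_cat mem_triangle_cells.
  case: s => /=; last by case: t {tsP rt} => -[h0 p0] b; rewrite /= !andbT.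
  by rewrite negb_or -!andbA [~~ _ && ~~ _]andbC.
rewrite region_count_triangle => [|s h p hT]; last first.
  rewrite /carve andbA (tsP t) ?mem_head //= /F; case: s hT => //= hT.
  apply/negP => /flatten_mapP[u uts]; rewrite mem_triangle_cells => /base_in_triangle.
  by apply/negP/(rP t u) => //; apply: rt.
transitivity (region_count N L (carve (carve P (in_triangle t)) F)).
  by apply: eq_region_count => s h p _; rewrite /carve andbAC.
rewrite IH //.
  by apply: eq_region_count => s h p _; rewrite /carve negb_or andbA.
move=> u s h p uts hu; rewrite /carve andbA (tsP u) ?inE ?uts ?orbT //=.
by apply: contraL hu => ht; apply: rP ht; apply: rt.
Qed.

Local Open Scope ring_scope.

(** * Determinants given by lists of rows *)

Section RowListDeterminant.
Variable F : comNzRingType.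
Implicit Types (r x y : nat -> F) (s rs : seq (nat -> F)).

(** Rows are functions on all of [nat] and missing rows are zero, so one list serves for every size
    and deleting the first column is a shift. *)
Definition rows_mx m rs : 'M[F]_m := \matrix_(i, j) nth (fun=> 0) rs i j.

Definition rdet m rs : F := \det (rows_mx m rs).

Lemma eq_rdet m rs rs' :
    (forall i j, nth (fun=> 0) rs i j = nth (fun=> 0) rs' i j) ->
  rdet m rs = rdet m rs'.
Proof. by move=> e; congr (\det _); apply/matrixP => i j; rewrite !mxE. Qed.

Lemma nth_mid (T : Type) (x0 : T) (s1 : seq T) (x : T) (s2 : seq T) i :
  nth x0 (s1 ++ x :: s2) i =
  if i == size s1 then x else nth x0 (s1 ++ x0 :: s2) i.
Proof.
rewrite !nth_cat; case: ltngtP => // [|->]; last by rewrite subnn.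
by rewrite -subn_gt0; case: (_ - _)%N.
Qed.

Lemma rdet_linear m s1 x y r s2 a b :
    (size s1 < m)%N -> (forall j, r j = a * x j + b * y j) ->
  rdet m (s1 ++ r :: s2) = a * rdet m (s1 ++ x :: s2) + b * rdet m (s1 ++ y :: s2).
Proof.
move=> s1m rE; apply: (@determinant_multilinear _ _ _ _ _ (Ordinal s1m)).
- apply/rowP => j; rewrite !mxE /= nth_mid eqxx nth_mid eqxx nth_mid eqxx.
  exact: rE.
- apply/matrixP => i j; rewrite !mxE nth_mid [in RHS]nth_mid.
  by have /negPf := neq_lift (Ordinal s1m) i; rewrite eq_sym -val_eqE /= => ->.
- apply/matrixP => i j; rewrite !mxE nth_mid [in RHS]nth_mid.
  by have /negPf := neq_lift (Ordinal s1m) i; rewrite eq_sym -val_eqE /= => ->.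
Qed.

Lemma rdet_sum (I : Type) (ps : seq I) (c : I -> F) (v : I -> nat -> F) m s1 r s2 :
    (size s1 < m)%N -> (forall j, r j = \sum_(p <- ps) c p * v p j) ->
  rdet m (s1 ++ r :: s2) = \sum_(p <- ps) c p * rdet m (s1 ++ v p :: s2).
Proof.
move=> s1m; elim: ps r => [|p ps IH] r rE.
  rewrite big_nil (@rdet_linear _ _ r r _ _ 0 0) // => [|j].
    by rewrite !mul0r addr0.
  by rewrite rE big_nil !mul0r addr0.
pose r' j := \sum_(p <- ps) c p * v p j.
rewrite big_cons -(IH r') // (@rdet_linear _ _ (v p) r' _ _ (c p) 1) ?mul1r // => j.
by rewrite rE big_cons mul1r.
Qed.

Lemma rdet_dup m rs i j : (i < j < m)%N ->
  nth (fun=> 0) rs i =1 nth (fun=> 0) rs j -> rdet m rs = 0.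
Proof.
move=> /andP[ij jm] e; have im := ltn_trans ij jm.
apply: (@determinant_alternate _ _ _ (Ordinal im) (Ordinal jm)) => [|k].
  by rewrite -val_eqE /= ltn_eqF.
by rewrite !mxE e.
Qed.

Lemma rdet_dup2 m s1 x s2 : ((size s1).+1 < m)%N ->
  rdet m (s1 ++ x :: x :: s2) = 0.
Proof.
move=> s1m; apply: (@rdet_dup _ _ (size s1) (size s1).+1); first by rewrite ltnSn.
by move=> j; rewrite !nth_cat ltnn subnn ltnNge leqnSn subSnn.
Qed.

(** Expand the determinant with [x + y] in both places: it vanishes, and so do the two terms with
    equal rows. *)
Lemma rdet_swap m s1 x y s2 : ((size s1).+1 < m)%N ->
  rdet m (s1 ++ x :: y :: s2) = - rdet m (s1 ++ y :: x :: s2).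
Proof.
move=> s1m; have s1m' := ltnW s1m.
pose z j := 1 * x j + 1 * y j.
have := @rdet_dup2 m s1 z s2 s1m.
have lin u : rdet m (s1 ++ u :: z :: s2) =
    rdet m (s1 ++ u :: x :: s2) + rdet m (s1 ++ u :: y :: s2).
  rewrite -!(cat_rcons u) (@rdet_linear _ _ x y z _ 1 1) ?size_rcons //.
  by rewrite !mul1r.
rewrite (@rdet_linear _ _ x y z _ 1 1) // !lin !rdet_dup2 //.
rewrite !mul1r add0r addr0 => /eqP.
by rewrite addr_eq0 => /eqP.
Qed.

Lemma rdet_sub m s1 x y z s2 : ((size s1).+1 < m)%N ->
    (forall j, z j = y j - x j) ->
  rdet m (s1 ++ x :: y :: s2) = rdet m (s1 ++ x :: z :: s2).
Proof.
move=> s1m zE; rewrite -!(cat_rcons x).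
rewrite (@rdet_linear _ _ y x z _ 1 (-1)) ?size_rcons //; last first.
  by move=> j; rewrite zE mul1r mulN1r.
by rewrite !cat_rcons rdet_dup2 // mulr0 addr0 mul1r.
Qed.

Lemma rdet_block_swap m s1 s2 s3 s4 :
    (size s1 + size s2 + size s3 <= m)%N ->
  rdet m (s1 ++ s2 ++ s3 ++ s4)
  = (-1) ^+ (size s2 * size s3) * rdet m (s1 ++ s3 ++ s2 ++ s4).
Proof.
have move1 s x s' s'' : (size s + size s' < m)%N ->
  rdet m (s ++ x :: s' ++ s'') = (-1) ^+ size s' * rdet m (s ++ s' ++ x :: s'').
  elim: s' s => [|y s' IH] s sm /=; first by rewrite mul1r.
  rewrite rdet_swap; last by rewrite /= in sm; lia.
  rewrite -cat_rcons IH ?size_rcons; last by rewrite /= in sm; lia.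
  by rewrite cat_rcons exprS mulN1r mulNr.
elim/last_ind: s2 s4 => [|s2 x IH] s4 sm; first by rewrite mul1r.
rewrite size_rcons in sm; rewrite cat_rcons catA move1; last by rewrite size_cat; lia.
rewrite -catA IH; last by lia.
by rewrite size_rcons mulSn exprD mulrA cat_rcons.
Qed.

Lemma rdet_first_col m r rs : (forall i, nth (fun=> 0) rs i 0%N = 0) ->
  rdet m.+1 (r :: rs) = r 0%N * rdet m [seq (fun j => x j.+1) | x <- rs].
Proof.
move=> rs0; rewrite /rdet (expand_det_col _ ord0) big_ord_recl big1 => [|i _]; last first.
  by rewrite mxE /= rs0 mul0r.
rewrite addr0 mxE /= /cofactor expr0 mul1r; congr (_ * \det _).
apply/matrixP => i j; rewrite !mxE /=.
have [irs|irs] := ltnP i (size rs); first by rewrite (nth_map (fun=> 0)).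
by rewrite !nth_default ?size_map.
Qed.

End RowListDeterminant.

Lemma rdet_perm (F : comNzRingType) (T : eqType) (f : T -> nat -> F) us vs :
    perm_eq us vs ->
  exists e : nat, rdet (size us) (map f us) = (-1) ^+ e * rdet (size us) (map f vs).
Proof.
have [m em] : {m | m = size us} by exists (size us).
rewrite -em; have {em} : (size (Nil (nat -> F)) + size us <= m)%N by rewrite em.
rewrite -[map f us]cat0s -[map f vs]cat0s.
elim: us (Nil (nat -> F)) vs => [|x us IH] s1 vs /= s1m uv.
  move: (perm_size uv) => /esym/size0nil ->.
  by exists 0%N; rewrite mul1r.
have xvs : x \in vs by rewrite -(perm_mem uv) mem_head.
case/splitPr: xvs uv => v1 v2.
have -> : perm_eq (x :: us) (v1 ++ x :: v2) = perm_eq us (v1 ++ v2).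
  by rewrite -[x :: v2]cat1s perm_sym perm_catCA /= perm_cons perm_sym.
move=> uv; have size_v : size us = (size v1 + size v2)%N.
  by rewrite (perm_size uv) size_cat.
have [|e] := IH (rcons s1 (f x)) (v1 ++ v2) _ uv; first by rewrite size_rcons; lia.
rewrite !cat_rcons => ->.
exists (e + size v1)%N; rewrite exprD -mulrA; congr (_ * _).
rewrite !map_cat /=.
have := @rdet_block_swap _ m s1 [:: f x] (map f v1) (map f v2).
rewrite /= mul1n size_map; apply; lia.
Qed.

(** * One row step of the determinant: differences and expansion *)

Section Interlacing.
Variables (F : comNzRingType) (G : nat -> nat -> nat -> F).

Definition cell_row (k : nat) (u : nat * nat) : nat -> F :=
  fun j => G u.1 u.2 (k + j).

Definition cdet m k (us : seq (nat * nat)) : F := rdet m (map (cell_row k) us).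

Definition at_height (h : nat) (A : seq nat) : seq (nat * nat) :=
  [seq (h, p) | p <- A].

Lemma size_at_height h A : size (at_height h A) = size A.
Proof. exact: size_map. Qed.

Lemma cdet_dup m k us : (size us <= m)%N -> ~~ uniq us -> cdet m k us = 0.
Proof.
move=> um /(uniqPn (0, 0)%N)[i [j [ij jus e]]].
apply: (@rdet_dup _ _ _ i j); first by rewrite ij (leq_trans jus).
by move=> l; rewrite !(nth_map (0, 0)%N) ?e // (ltn_trans ij).
Qed.

Variables (h : nat) (e : F) (sgn_at : nat -> F).
Hypothesis Gh : forall p, G h p h = e.
Hypothesis G_diff : forall p j, (h < j)%N ->
  G h p.+1 j - G h p j = sgn_at p * G h.+1 p j.

Fixpoint differences (k x : nat) (s : seq nat) : seq (nat -> F) :=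
  if s is y :: s' then
    (fun j => G h y (k + j) - G h x (k + j)) :: differences k y s'
  else [::].

Lemma size_differences k x s : size (differences k x s) = size s.
Proof. by elim: s x => //= y s IH x; rewrite IH. Qed.

(** Consecutive rows are subtracted starting from the last one, so that each subtracted row is still
    unchanged. *)
Lemma rdet_differences m pre x s rs : (size pre + size s < m)%N ->
  rdet m (pre ++ map (cell_row h) (at_height h (x :: s)) ++ rs)
  = rdet m (pre ++ cell_row h (h, x) :: differences h x s ++ rs).
Proof.
elim: s pre x => [//|y s IH] pre x /= sm.
rewrite -cat_rcons IH ?size_rcons; last by lia.
rewrite cat_rcons; apply: rdet_sub => //.
by apply: leq_ltn_trans sm; lia.
Qed.

Lemma G_telescope x y j : (x <= y)%N -> (h < j)%N ->
  G h y j - G h x j = \sum_(p <- index_iota x y) sgn_at p * G h.+1 p j.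
Proof.
move=> xy hj; rewrite -(telescope_sumr (fun p => G h p j) xy).
by apply: eq_bigr => p _; rewrite G_diff.
Qed.

(** Each difference telescopes over its gap, and multilinearity selects one position per gap, that
    is, an interlacing list. *)
Lemma rdet_interlacing m pre x s rs : path ltn x s ->
    (size pre + size s <= m)%N ->
  rdet m (pre ++ differences h.+1 x s ++ rs)
  = \sum_(t <- interlacing x s) (\prod_(p <- t) sgn_at p)
      * rdet m (pre ++ map (cell_row h.+1) (at_height h.+1 t) ++ rs).
Proof.
elim: s x pre => [|y s IH] x pre /= => [_ _|/andP[xy ys] sm].
  by rewrite big_seq1 big_nil mul1r.
rewrite (@rdet_sum _ _ (index_iota x y) sgn_at (fun p j => G h.+1 p (h.+1 + j))).
- rewrite big_allpairs_dep /=; apply: eq_bigr => p _.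
  rewrite -cat_rcons IH //; last by rewrite size_rcons; lia.
  rewrite big_distrr /=; apply: eq_bigr => t _.
  by rewrite big_cons cat_rcons mulrA.
- by lia.
by move=> j; apply: G_telescope; [exact: ltnW|lia].
Qed.

(** In column [h] the differences vanish because the diagonal value [e] is constant, and so do the
    rows of [us]; only the first row remains in the expansion. *)
Lemma cdet_row_step m x s us : path ltn x s -> (size s <= m)%N ->
    (forall u, u \in us -> G u.1 u.2 h = 0) ->
  cdet m.+1 h (at_height h (x :: s) ++ us)
  = e * \sum_(t <- interlacing x s) (\prod_(p <- t) sgn_at p)
      * cdet m h.+1 (at_height h.+1 t ++ us).
Proof.
move=> xs sm us0; rewrite /cdet map_cat (@rdet_differences _ [::]) //=.
rewrite rdet_first_col => [|i]; last first.
  rewrite nth_cat size_differences; case: ltnP => [{sm}|_].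
    elim: s x i {xs} => // y s IH x [|i] /= il; first by rewrite addn0 !Gh subrr.
    exact: IH.
  have [ius|ius] := ltnP (i - size s) (size us); last by rewrite nth_default ?size_map.
  rewrite (nth_map (0, 0)%N) // /cell_row addn0; apply: us0; exact: mem_nth.
have -> : cell_row h (h, x) 0%N = e by rewrite /cell_row addn0 Gh.
congr (_ * _).
(* Once column [h] is deleted, the offset [h] becomes [h.+1]. *)
transitivity (rdet m ([::] ++ differences h.+1 x s ++ map (cell_row h.+1) us)).
  apply: eq_rdet => i j /=.
  have cell_shift u : cell_row h u j.+1 = cell_row h.+1 u j.
    by rewrite /cell_row addSnnS.
  have diff_shift x' s' k : nth (fun=> 0) (differences h x' s') k j.+1
                            = nth (fun=> 0) (differences h.+1 x' s') k j.
    by elim: s' x' k => [|y s' IH] x' [|k] //=; rewrite addSnnS.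
  have [il|il] := ltnP i (size (differences h x s ++ map (cell_row h) us)).
    rewrite (nth_map (fun=> 0)) // !nth_cat !size_differences.
    case: ltnP => si; first exact: diff_shift.
    rewrite size_cat size_differences size_map in il.
    by rewrite !(nth_map (0, 0)%N) ?cell_shift //; lia.
  by move: il; rewrite size_cat size_map size_differences => il;
    rewrite !nth_default // ?(size_cat, size_map, size_differences).
rewrite rdet_interlacing //; apply: eq_bigr => t _; congr (_ * _).
by rewrite /cdet map_cat.
Qed.

End Interlacing.

(** * Tilings of a trapezoid with triangular holes *)

Lemma interlacingP x s t : t \in interlacing x s -> path ltn x s ->
  [/\ size t = size s, sorted ltn t, all (leq x) t & all (gtn (last x s)) t].
Proof.
elim: s x t => [|y s IH] x t /=; first by rewrite inE => /eqP->.
move=> /allpairsPdep[p [t' [+ t's ->]]]; rewrite mem_index_iota => /andP[xp py].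
move=> /andP[xy ys]; have [st sort_t yt t_last] := IH y t' t's ys.
have y_last : (y <= last y s)%N.
  case: s ys {IH t's st t_last} => //= z s /andP[yz zs].
  apply/ltnW/(leq_trans yz); elim: s z zs {yz} => //= w s IHs z /andP[zw ws].
  exact: (leq_trans (ltnW zw) (IHs _ ws)).
split=> /=.
- by rewrite st.
- rewrite path_sortedE; last exact: ltn_trans.
  by rewrite sort_t andbT; apply: sub_all yt => q; apply: leq_trans.
- by rewrite xp; apply: sub_all yt => q; apply/leq_trans/ltnW.
- by rewrite t_last andbT; apply: leq_trans py y_last.
Qed.

Lemma sorted_split (A : seq nat) (x : nat) : sorted ltn A ->
  A = [seq p <- A | (p < x)%N] ++ [seq p <- A | (x <= p)%N].
Proof.
move=> sA; apply: (irr_sorted_eq ltn_trans ltnn) => //.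
  move: sA; rewrite !(sorted_pairwise ltn_trans) pairwise_cat => pA.
  rewrite !pairwise_filter // !andbT.
  apply/allrelP => p q; rewrite !mem_filter => /andP[px _] /andP[xq _].
  exact: leq_trans px xq.
by move=> p; rewrite mem_cat !mem_filter -andb_orl ltnNge orNb.
Qed.

Definition cells (ts : seq (nat * nat * nat)) : seq (nat * nat) :=
  flatten [seq triangle_cells t | t <- ts].

Definition hole_sign (ts : seq (nat * nat * nat)) (h p : nat) : nat :=
  \sum_(t <- ts | t.1.1 == h) t.2 * (t.1.2 <= p).

Definition height_leq (t u : nat * nat * nat) := (t.1.1 <= u.1.1)%N.

(* [hole_sign] is an exponent of the sign s. *)
Definition gauged (ts : seq (nat * nat * nat)) h (G : nat -> nat -> nat -> rat) :=
  forall h' p j, (h <= h')%N -> (h' < j)%N ->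
  G h' p.+1 j - G h' p j = (-1) ^+ hole_sign ts h'.+1 p * G h'.+1 p j.

Lemma prodr_exp_sum (F : comNzRingType) (a : F) (T : Type) (r : seq T) (f : T -> nat) :
  \prod_(p <- r) a ^+ f p = a ^+ (\sum_(p <- r) f p)%N.
Proof. by rewrite (big_morph _ (exprD a) (expr0 _)). Qed.

Section MainInduction.
Variables (N L : nat) (G : nat -> nat -> nat -> rat) (ee : nat -> nat).
Hypothesis NL : (N <= L)%N.
Hypothesis G_diag : forall h p, G h p h = (-1) ^+ ee h.
Hypothesis G_low : forall h p j, (j < h)%N -> G h p j = 0.

Let at_rank h p := (0 < p)%N && (p + h <= L)%N.

(** The size condition makes the determinant of [row_formula] square, with columns from [h] to
    [N - 1]; passing to an interlacing list lowers both sides by one. *)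
Definition row_state ts h A := [/\ sorted ltn A, all (at_rank h) A,
  uniq (at_height h A ++ cells ts) & (size A + size (cells ts) = N - h)%N].

(* The sum of [hole_sign] over A anticipates the sorting of the bases still to be
   inserted in row h; e does not depend on A. *)
Definition row_formula ts h := exists e : nat, forall A, row_state ts h A ->
  (region_count N L (rows_above (cells ts) h A))%:R =
  (-1) ^+ (e + \sum_(p <- A) hole_sign ts h p)%N
    * cdet G (N - h) h (at_height h A ++ cells ts).

Lemma row_formula_end ts h : (N <= h)%N -> row_formula ts h.
Proof.
move=> Nh; exists 0%N => A [_ _ _]; have -> : (N - h = 0)%N by lia.
move=> /eqP; rewrite addn_eq0 !size_eq0 => /andP[/eqP-> /eqP->].
rewrite big_nil mul1r /cdet /rdet det_mx00 -[RHS]/(1%:R); congr (_%:R).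
rewrite -M_fset0; congr M; apply/fsetP => t; rewrite inE.
apply/negP => tR; have [s [h' [p et]]] := subregionP tR; move: tR.
by rewrite et in_subregion /in_trapezoid /rows_above; lia.
Qed.

(** Inserting the base into its sorted place in [A] exchanges its rows with those of the elements of
    [A] on its right; the resulting sign is the share of this hole in [hole_sign]. *)
Lemma row_formula_hole t ts h : t.1.1 = h -> all (at_rank h) (iota t.1.2 t.2) ->
  row_formula ts h -> row_formula (t :: ts) h.
Proof.
case: t => -[h0 x] b /= -> {h0} bT [e eP].
(* The other holes of the row also contribute at the positions of the base, by an amount that does
   not depend on [A]. *)
exists (e + \sum_(p <- iota x b) hole_sign ts h p)%N => A [sA bA uA szA].
pose A1 := [seq p <- A | (p < x)%N]; pose A2 := [seq p <- A | (x <= p)%N].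
have eA : A = A1 ++ A2 by apply: sorted_split.
have cE : cells ((h, x, b) :: ts) = at_height h (iota x b) ++ cells ts by [].
have Ax p : p \in A -> (x <= p)%N -> (x + b <= p)%N.
  move=> pA xp; rewrite leqNgt; apply/negP => pxb.
  move: uA; rewrite cE catA cat_uniq => /andP[+ _]; rewrite cat_uniq => /and3P[_ + _].
  by case/hasP; exists (h, p); apply/map_f => //; rewrite mem_iota xp.
have perm_state : perm_eq (at_height h (A1 ++ iota x b ++ A2) ++ cells ts)
                          (at_height h A ++ cells ((h, x, b) :: ts)).
  rewrite cE [X in perm_eq _ X]catA perm_cat2r /at_height -map_cat perm_map //.
  rewrite {1}eA -catA perm_cat2l.
  by rewrite perm_catC.
have -> : region_count N L (rows_above (cells ((h, x, b) :: ts)) h A) =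
          region_count N L (rows_above (cells ts) h (A1 ++ iota x b ++ A2)).
  apply: eq_region_count => s h' p _; rewrite /rows_above cE !mem_cat {1}eA mem_cat.
  have -> : ((h', p) \in at_height h (iota x b)) = (h' == h) && (p \in iota x b).
    apply/mapP/andP => [[q qi [-> ->]]|[/eqP-> pi]]; first by rewrite eqxx.
    by exists p.
  case: (h <= h')%N => //=; case: s => //=.
  by case: (h' == h); case: (p \in A1); case: (p \in A2); case: (p \in iota x b);
    case: ((h', p) \in cells ts).
rewrite eP; last first.
  split.
  - rewrite (sorted_pairwise ltn_trans) !pairwise_cat.
    move: (sA); rewrite (sorted_pairwise ltn_trans) => pA.
    rewrite !pairwise_filter // -(sorted_pairwise ltn_trans) iota_ltn_sorted /= !andbT.
    rewrite allrel_catr; apply/andP; split; [apply/andP; split|];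
      apply/allrelP => p q; rewrite ?mem_filter ?mem_iota.
    + by move=> /andP[? _] /andP[? _]; lia.
    + by move=> /andP[? _] /andP[? _]; lia.
    + by move=> /andP[? ?] /andP[xq qA]; have := Ax q qA xq; lia.
  - by move: bA; rewrite {1}eA !all_cat bT => /andP[-> ->].
  - by rewrite (perm_uniq perm_state).
  - have := perm_size perm_state; rewrite ![size (at_height _ _ ++ _)]size_cat.
    by rewrite !size_at_height => ->; rewrite -[RHS]szA cE [in RHS]size_cat size_at_height.
rewrite [in RHS]cE /cdet /at_height [in map _ A]eA !map_cat -!catA rdet_block_swap.
  2: by rewrite !size_map; move: szA; rewrite cE eA !size_cat !size_at_height; lia.
rewrite mulrA -exprD; congr (_ ^+ _ * _).
rewrite !size_map size_iota !big_cat /=.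
have hsE p : hole_sign ((h, x, b) :: ts) h p = (b * (x <= p) + hole_sign ts h p)%N.
  by rewrite /hole_sign big_cons /= eqxx.
have e1 : (\sum_(p <- A1) hole_sign ((h, x, b) :: ts) h p
           = \sum_(p <- A1) hole_sign ts h p)%N.
  apply: eq_big_seq => p; rewrite mem_filter hsE => /andP[px _].
  by rewrite leqNgt px muln0.
have e2 : (\sum_(p <- A2) hole_sign ((h, x, b) :: ts) h p
           = b * size A2 + \sum_(p <- A2) hole_sign ts h p)%N.
  transitivity (\sum_(p <- A2) (b + hole_sign ts h p))%N.
    apply: eq_big_seq => p; rewrite mem_filter hsE => /andP[xp _].
    by rewrite xp muln1.
  by rewrite big_split /= big_const_seq count_predT iter_addn_0.
rewrite [in RHS]eA big_cat /= e1 e2; lia.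
Qed.

(** With no hole in row [h], [row_transfer] and [cdet_row_step] expand both sides over the same
    interlacing lists. *)
Lemma row_formula_step ts h : (h < N)%N -> all (fun u => h < u.1)%N (cells ts) ->
    (forall p, hole_sign ts h p = 0%N) ->
    gauged ts h G -> row_formula ts h.+1 -> row_formula ts h.
Proof.
move=> hN ts_above hs0 gts [e eP]; exists (e + ee h)%N => A.
have Nh : (N - h)%N = (N - h.+1).+1 by lia.
have low u : u \in cells ts -> G u.1 u.2 h = 0.
  by move=> /(allP ts_above); apply: G_low.
(* If [A] is empty, the row cannot be filled, and all rows of the determinant vanish in column
   [h]. *)
case: A => [|x s] [sA bA uA szA].
  rewrite row_transfer_nil //; last by lia.
  rewrite Nh in szA *; move: szA low; rewrite /cdet /=; case: (cells ts) => //= u us _ low.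
  rewrite rdet_first_col.
    by rewrite /cell_row addn0 low ?mem_head // mul0r mulr0.
  move=> i; have [ius|ius] := ltnP i (size us); last by rewrite nth_default ?size_map.
  rewrite (nth_map (0, 0)%N) // /cell_row addn0 low //.
  by rewrite inE mem_nth ?orbT.
rewrite (row_transfer hN) // natr_sum Nh.
rewrite (@cdet_row_step _ _ h ((-1) ^+ ee h)
  (fun p => (-1) ^+ hole_sign ts h.+1 p)) //; last 2 first.
- by move=> p j hj; apply: gts.
- by move: szA => /=; lia.
have -> : (\sum_(p <- x :: s) hole_sign ts h p)%N = 0%N by rewrite big1.
(* The diagonal sign [(-1) ^+ ee h] occurs twice and cancels. *)
rewrite addn0 mulrA -exprD -addnA addnn -signr_odd oddD odd_double addbF signr_odd.
rewrite big_distrr /= big_mkcond; apply: eq_big_seq => t t_xs.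
have [size_t sort_t xt t_last] := interlacingP t_xs sA.
have t_rank : all (at_rank h.+1) t.
  suff rank (p : nat) : p \in t -> at_rank h.+1 p by apply/allP => p; apply: rank.
  move=> pt; have /= xp := allP xt p pt; have /= pl := allP t_last p pt.
  have /andP[_ lL] := allP bA _ (mem_last x s).
  have /andP[x0 _] := allP bA x (mem_head x s).
  rewrite /at_rank (leq_trans x0 xp) addnS; apply: leq_trans lL.
  by rewrite ltn_add2r.
rewrite prodr_exp_sum.
have st_uniq_cells : uniq (cells ts).
  by move: uA; rewrite cat_uniq => /and3P[].
(* A list meeting a base of row [h.+1] is excluded from the tilings and gives the determinant a
   repeated row. *)
case: ifP => av; last first.
  rewrite cdet_dup ?mulr0 //.
    by move: szA; rewrite size_cat size_at_height size_t /=; lia.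
  apply: contraFN av; rewrite cat_uniq => /and3P[_ /hasPn dis _].
  apply/allP => p pt; rewrite /available; apply/andP; split.
    have : (0 < size t)%N by case: (t) pt.
    by move: szA => /=; rewrite size_t; lia.
  apply/negP => hp; have := dis _ hp; case/negP; exact: map_f.
rewrite eP ?mulrA -?exprD //; split=> //.
  rewrite cat_uniq st_uniq_cells andbT map_inj_uniq ?(sorted_uniq ltn_trans ltnn) //=.
    apply/hasPn => -[h' p] hp; apply/mapP => -[q qt [eh eq]]; subst h' p.
    by have /andP[_] := allP av q qt; rewrite hp.
  by move=> p q [].
by move: szA => /=; rewrite size_t; lia.
Qed.

(** Induction on the number of remaining rows plus remaining holes. As the holes are sorted by
    height, one in row [h] is found at the head and is treated before passing to the next row. *)
Lemma row_formulaP ts h : sorted height_leq ts -> all (fun t => h <= t.1.1)%N ts ->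
    all (fun u => at_rank u.1 u.2) (cells ts) -> gauged ts h G ->
  row_formula ts h.
Proof.
have [k] := ubnP (N - h + size ts); elim: k ts h => // k IH ts h k_lt.
move=> ts_sorted ts_h ts_rank gts.
have [Nh|hN] := leqP N h; first exact: row_formula_end.
have [ht|no_t] := boolP (has (fun t => t.1.1 == h) ts).
  case: ts ts_sorted ts_h ts_rank gts k_lt ht => [//|t ts] /= t_ts /andP[ht ts_h].
  rewrite /cells /= all_cat => /andP[t_rank ts_rank] gts k_lt t_at.
  have ts_t : all (height_leq t) ts.
    by apply: order_path_min t_ts => ? ? ?; apply: leq_trans.
  have {t_at} th : t.1.1 = h.
    case/orP: t_at => [/eqP//|/hasP[u uts /eqP uh]].
    by have := allP ts_t u uts; rewrite /height_leq uh; lia.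
  apply: row_formula_hole => //.
    by apply/allP => p /(map_f (pair t.1.1)) /(allP t_rank); rewrite th.
  apply: IH => //; first by lia.
    exact: path_sorted t_ts.
  move=> h' p j hh' h'j; rewrite gts //; congr (_ ^+ _ * _).
  by rewrite /hole_sign big_cons th; case: eqP => //; lia.
have ts_gt : all (fun t => h < t.1.1)%N ts.
  apply/allP => t tts; rewrite ltn_neqAle (allP ts_h) // andbT eq_sym.
  by apply: contra no_t => th; apply/hasP; exists t.
apply: row_formula_step => //.
- by apply/allP => u /flatten_mapP[t tts /mapP[p _ ->]]; apply: (allP ts_gt).
- move=> p; rewrite /hole_sign big_seq_cond big_pred0 // => t.
  by apply/negP => /andP[tts th]; case/negP: no_t; apply/hasP; exists t.
apply: IH => //; first by lia.
by move=> h' p j hh'; apply: gts; apply: ltnW.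
Qed.

End MainInduction.

(** * Trapezoids with disjoint triangular holes *)

Definition triangle_at (t : nat * nat * nat) : {fset unit_triangle} :=
  up_triangle t.2 t.1.1%:Z t.1.2%:Z.

Lemma in_triangle_at t s (h p : nat) :
  ((s, h%:Z, p%:Z) \in triangle_at t) = in_triangle t s h p.
Proof.
by case: t => -[h0 p0] b; rewrite /triangle_at /up_triangle mem_trapezoid_at /=; lia.
Qed.

Lemma holes_subregion N L (ts : seq (nat * nat * nat)) :
  trapezoid N L `\` \bigcup_(t <- ts) triangle_at t =
  subregion N L (carve (fun _ _ _ => true)
    (fun s h p => has (fun t => in_triangle t s h p) ts)).
Proof.
have trapE : trapezoid N L = subregion N L (fun _ _ _ => true).
  by apply/fsetP => t; rewrite [RHS]in_fset [RHS]inE /= andbT.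
apply: eq_fset_subregion => [t|s h p].
  by rewrite in_fsetD trapE => /andP[_ /subregionP].
rewrite in_fsetD trapE in_subregion andbT andbC; congr (_ && ~~ _).
apply/bigfcupP/hasP => [[t]|[t tts ht]].
  by rewrite andbT in_triangle_at => tts ht; exists t.
by exists t; rewrite ?tts ?in_triangle_at.
Qed.

Lemma disjoint_triangle_at t u s h p :
  [disjoint triangle_at t & triangle_at u] -> in_triangle t s h p -> ~~ in_triangle u s h p.
Proof. by rewrite -!in_triangle_at => /fdisjointP; apply. Qed.

Lemma in_triangle_in_trapezoid N L ts t s h p :
    all (fun t => triangle_at t `<=` trapezoid N L) ts -> t \in ts ->
  in_triangle t s h p -> in_trapezoid N L s h p.
Proof.
move=> ts_trap /(allP ts_trap)/fsubsetP sub; rewrite -in_triangle_at => /sub.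
by rewrite mem_trapezoid_at /in_trapezoid /=; lia.
Qed.

Lemma mem_cells us h p :
  ((h, p) \in cells us) = has (fun t => in_base t true h p) us.
Proof.
apply/flatten_mapP/hasP => -[t tus]; first by rewrite mem_triangle_cells; exists t.
by move=> ht; exists t; rewrite ?mem_triangle_cells.
Qed.

Lemma size_cells us : size (cells us) = (\sum_(t <- us) t.2)%N.
Proof.
elim: us => [|t us IH]; first by rewrite big_nil.
by rewrite /cells /= size_cat -/(cells us) IH big_cons size_map size_iota.
Qed.

Section HolesFormula.
Variables (N L : nat) (ts : seq (nat * nat * nat)).
Hypothesis NL : (N <= L)%N.
Hypothesis ts_trap : all (fun t => triangle_at t `<=` trapezoid N L) ts.
Hypothesis ts_disj : pairwise (fun t u => [disjoint triangle_at t & triangle_at u]) ts.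

Lemma M_holes :
  M (trapezoid N L `\` \bigcup_(t <- ts) triangle_at t) =
  region_count N L (rows_above (cells ts) 0 [::]).
Proof.
rewrite holes_subregion -/(region_count _ _ _) -(region_count_triangles _ _ ts_disj).
- apply: eq_region_count => s h p _.
  by rewrite /carve /rows_above in_nil andbF andbT /= negb_and; case: s.
- by move=> t u s h p; apply: disjoint_triangle_at.
by move=> t s h p tts ht; rewrite (in_triangle_in_trapezoid ts_trap tts ht).
Qed.

Lemma uniq_cells : uniq (cells ts).
Proof.
move: ts_disj; elim: ts => //= t us IH /andP[/allP t_us us_disj].
rewrite /cells /= cat_uniq -/(cells us) IH // andbT; apply/andP; split.
  by rewrite map_inj_uniq ?iota_uniq // => p q [].
apply/hasPn => -[h p]; rewrite mem_cells mem_triangle_cells => /hasP[u uus hu].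
apply/negP => /base_in_triangle ht; move: (base_in_triangle hu).
by apply/negP/(disjoint_triangle_at _ ht)/t_us.
Qed.

Lemma cells_rank u : u \in cells ts -> (0 < u.2)%N && (u.2 + u.1 <= L)%N.
Proof.
case: u => h p; rewrite mem_cells => /hasP[t tts /base_in_triangle ht].
by have := in_triangle_in_trapezoid ts_trap tts ht; rewrite /in_trapezoid addn0
  => /and3P[_ -> ->].
Qed.

(** The induction starts in row 0 with [A] empty; the sum of the sides makes the determinant square.
    Sorting the holes by height only permutes its rows, which the absolute value does not see. *)
Theorem holes_formula (G : nat -> nat -> nat -> rat) (ee : nat -> nat) :
    (forall h p, G h p h = (-1) ^+ ee h) ->
    (forall h p j, (j < h)%N -> G h p j = 0) ->
    gauged ts 0 G -> (\sum_(t <- ts) t.2)%N = N ->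
  (M (trapezoid N L `\` \bigcup_(t <- ts) triangle_at t))%:R = `|cdet G N 0 (cells ts)|.
Proof.
move=> G_diag G_low gts ts_size; rewrite M_holes.
pose ts' := sort height_leq ts.
have ts'ts : perm_eq ts' ts by rewrite perm_sort.
have cells' : perm_eq (cells ts') (cells ts).
  by apply: perm_flatten; apply: perm_map.
have hs' h p : hole_sign ts' h p = hole_sign ts h p by apply: perm_big.
have [||||e eP] := @row_formulaP N L G ee NL G_diag G_low ts' 0.
- by apply: sort_sorted => t u; apply: leq_total.
- exact/allP.
- by apply/allP => u; rewrite (perm_mem cells'); apply: cells_rank.
- by move=> h p j h0 hj; rewrite gts // hs'.
have -> : region_count N L (rows_above (cells ts) 0 [::])
          = region_count N L (rows_above (cells ts') 0 [::]).
  by apply: eq_region_count => s h p _; rewrite /rows_above (perm_mem cells').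
rewrite -[LHS]ger0_norm ?ler0n // eP; last first.
  split; rewrite //= ?(perm_uniq cells') ?uniq_cells //.
  by rewrite (perm_size cells') size_cells ts_size subn0.
have [e'] := rdet_perm (cell_row G 0) cells'.
rewrite (perm_size cells') size_cells ts_size subn0 /cdet cat0s => ->.
by rewrite !normrM !normrX normrN1 !expr1n !mul1r.
Qed.

End HolesFormula.

(** * The gauge of the satellites *)

Lemma binom_neg x m : m < 0 -> binom x m = 0.
Proof. by case: m. Qed.

Lemma binom0r x : binom x 0 = 1.
Proof. by rewrite /binom /= big_ord0 divr1. Qed.

Lemma binomS x m : binom (x + 1) m = binom x m + binom x (m - 1).
Proof.
case: m => [[|m]|m]; [by rewrite !binom0r addr0| |by rewrite addr0].
have -> : m.+1%:Z - 1 = m by lia.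
rewrite /binom big_ord_recl [in RHS]big_ord_recr /= subr0.
have shift i : (x + 1)%:~R - (bump 0 i)%:R = x%:~R - i%:R :> rat.
  by rewrite intrD /bump add1n -[i.+1]addn1 natrD; ring.
under eq_bigr do rewrite shift.
set pr := \prod_(i < m) _; rewrite factS natrM intrD.
have : m.+1%:R != 0 :> rat by rewrite pnatr_eq0.
have : (m`!)%:R != 0 :> rat by rewrite pnatr_eq0 -lt0n fact_gt0.
rewrite -addn1 natrD => m0 f0; field.
by rewrite m0 f0.
Qed.

Lemma binom_small (x m : int) : 0 <= x -> x < m -> binom x m = 0.
Proof.
case: x m => [x|//] [m|//] _ xm; have {}xm : (x < m)%N by lia.
by rewrite /binom (bigD1 (Ordinal xm)) //= subrr !mul0r.
Qed.

Lemma binom0l (m : int) : binom 0 m = (m == 0)%:R.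
Proof.
have [->|m0] := eqVneq m 0; first by rewrite binom0r.
by have [mneg|mpos] := ltP m 0; [exact: binom_neg|apply: binom_small; lia].
Qed.

Section Gauge.
Variables (b1 b2 b3 h1 h2 h3 : nat) (x1 : int).
Hypothesis x1_le0 : x1 <= 0.

(* [gauge h x j] is G_h(p, j) for x = p - c, where the cuts are the lines x = 0 and
   x = x1.  The three formulas agree on the cuts ([left_middle], [middle_right]), so
   that the recurrence is Pascal's rule on each side of them. *)
Definition cut (b h0 h : nat) : rat := (-1) ^+ (b * (h0 <= h)).

(** By Vandermonde, [binom x (j - h)] is the sum over all [q] of [binom (x - x1) (q - h) * binom x1
    (j - q)], its Newton expansion at [x1]. The correction multiplies the terms with [h1 <= q] by
    [(-1) ^+ b1]. *)
Definition left_poly (h : nat) (x : int) (j : nat) : rat :=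
  binom x (j%:Z - h%:Z) + ((-1) ^+ b1 - 1) * \sum_(q < j.+1 | (h1 <= q)%N)
    binom (x - x1) (q%:Z - h%:Z) * binom x1 (j%:Z - q%:Z).

Definition gauge_left h x j := cut b3 h3 j * left_poly h x j.

Definition gauge_middle h x j :=
  cut b1 h1 h * cut b3 h3 j * binom x (j%:Z - h%:Z).

(** At [x = 0] only [j = h] contributes, where a sign of columns can be traded for a sign of rows:
    across the cut the sign of [b3] passes from columns to rows, and the two signs of [b2] cancel
    there. *)
Definition gauge_right h x j :=
  cut b1 h1 h * cut b2 h2 h * cut b3 h3 h * cut b2 h2 j * binom x (j%:Z - h%:Z).

Definition gauge h x j :=
  if x < x1 then gauge_left h x j
  else if x < 0 then gauge_middle h x j else gauge_right h x j.

Lemma cut_sqr b h0 h : cut b h0 h * cut b h0 h = 1.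
Proof. by rewrite /cut -expr2 sqrr_sign. Qed.

Lemma cutS b h0 h : cut b h0 h = (-1) ^+ (b * (h0 == h.+1)) * cut b h0 h.+1.
Proof.
rewrite /cut; have [->|ne] := eqVneq h0 h.+1.
  by rewrite leqnn ltnn muln0 muln1 -expr2 sqrr_sign.
have -> : (h0 <= h.+1)%N = (h0 <= h)%N by lia.
by rewrite muln0 mul1r.
Qed.

Lemma sum_delta h j (f : nat -> rat) : (h <= j)%N ->
  \sum_(q < j.+1 | (h1 <= q)%N) binom 0 (q%:Z - h%:Z) * f q = (h1 <= h)%:R * f h.
Proof.
move=> hj; rewrite big_mkcond (bigD1 (Ordinal (hj : (h < j.+1)%N))) //=.
rewrite big1 => [|q qh]; last first.
  rewrite binom0l; have -> : (q%:Z - h%:Z == 0) = false.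
    by move: qh; rewrite -val_eqE /=; lia.
  by rewrite mul0r if_same.
rewrite subrr binom0r mul1r addr0.
by case: (h1 <= h)%N; rewrite ?mul1r ?mul0r.
Qed.

(** At [x = x1] only the term [q = h] of the correction survives, which yields the row sign
    [cut b1 h1 h]. *)
Lemma left_middle h j : (h <= j)%N -> gauge_left h x1 j = gauge_middle h x1 j.
Proof.
move=> hj; rewrite /gauge_left /gauge_middle /left_poly subrr.
rewrite (sum_delta (fun q => binom x1 (j%:Z - q%:Z))) // /cut.
by case: (h1 <= h)%N; rewrite /= ?muln1 ?muln0; ring.
Qed.

Lemma middle_right h j : (h <= j)%N -> gauge_middle h 0 j = gauge_right h 0 j.
Proof.
move=> hj; rewrite /gauge_middle /gauge_right binom0l.
have [jh|_] := eqVneq (j%:Z - h%:Z) 0; last by rewrite !mulr0.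
have -> : j = h by lia.
have := cut_sqr b2 h2 h; move: (cut b2 h2 h) => u u2.
by rewrite /= !mulr1 -[LHS]mulr1 -u2; ring.
Qed.

Lemma gaugeE_left h (x : int) j : (h <= j)%N -> x <= x1 -> gauge h x j = gauge_left h x j.
Proof.
move=> hj; rewrite le_eqVlt => /orP[/eqP->|xx]; last by rewrite /gauge xx.
rewrite left_middle // /gauge ltxx; case: ltP => // x10.
have -> : x1 = 0 by lia.
by rewrite middle_right.
Qed.

Lemma gaugeE_middle h (x : int) j : (h <= j)%N -> x1 <= x -> x <= 0 ->
  gauge h x j = gauge_middle h x j.
Proof.
move=> hj xx; rewrite le_eqVlt => /orP[/eqP x0|x0]; last first.
  by rewrite /gauge ltNge xx x0.
by rewrite /gauge x0 ltNge x1_le0 /= middle_right.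
Qed.

Lemma gaugeE_right h (x : int) j : 0 <= x -> gauge h x j = gauge_right h x j.
Proof. by move=> x0; rewrite /gauge !ltNge x0 (le_trans x1_le0). Qed.

Lemma left_polyS h x j :
  left_poly h (x + 1) j - left_poly h x j = left_poly h.+1 x j.
Proof.
rewrite /left_poly binomS.
have -> : x + 1 - x1 = x - x1 + 1 by ring.
under eq_bigr do rewrite binomS mulrDl.
rewrite big_split /=.
have shift (q : nat) : q%:Z - h%:Z - 1 = q%:Z - h.+1%:Z by lia.
by rewrite shift; under [X in _ + _ * (_ + X) - _]eq_bigr do rewrite shift; ring.
Qed.

Lemma gauge_low h x j : (j < h)%N -> gauge h x j = 0.
Proof.
move=> jh; rewrite /gauge /gauge_left /gauge_middle /gauge_right /left_poly.
rewrite binom_neg ?mulr0; last by lia.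
rewrite big1 ?mulr0 ?addr0 ?mulr0 ?if_same // => q _.
by rewrite binom_neg ?mul0r //; have := ltn_ord q; lia.
Qed.

Definition gauge_exponent h := (b1 * (h1 <= h) + b3 * (h3 <= h))%N.

Lemma gauge_diag h x : gauge h x h = (-1) ^+ gauge_exponent h.
Proof.
have eE : (-1) ^+ gauge_exponent h = cut b1 h1 h * cut b3 h3 h by rewrite exprD.
rewrite eE /gauge; case: ifP => _; last case: ifP => _.
- rewrite /gauge_left /left_poly subrr binom0r.
  rewrite (_ : \sum_(q < h.+1 | (h1 <= q)%N) _ = (h1 <= h)%:R).
    rewrite mulrC; congr (_ * _); rewrite /cut.
    by case: (h1 <= h)%N; rewrite /= ?muln1 ?muln0; ring.
  rewrite big_mkcond big_ord_recr /= big1 => [|q _].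
    by rewrite subrr !binom0r mul1r add0r; case: ifP.
  rewrite (@binom_neg _ (q%:Z - h%:Z)) ?mul0r ?if_same //.
  by have := ltn_ord q; lia.
- by rewrite /gauge_middle subrr binom0r mulr1.
rewrite /gauge_right subrr binom0r mulr1.
have := cut_sqr b2 h2 h; move: (cut b2 h2 h) => u u2.
by rewrite -[RHS]mulr1 -u2; ring.
Qed.

(** Both [x] and [x + 1] lie in the closed range of one of the three formulas, where Pascal's rule
    applies. The signs arise because the row factors [cut] change only on reaching the height of a
    satellite. *)
Lemma gauge_diff h x j : (h < j)%N ->
  gauge h (x + 1) j - gauge h x j =
  (-1) ^+ (b1 * ((h1 == h.+1) && (x1 <= x))) *
  (-1) ^+ (b2 * ((h2 == h.+1) && (0 <= x))) *
  (-1) ^+ (b3 * ((h3 == h.+1) && (0 <= x))) * gauge h.+1 x j.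
Proof.
move=> hj; have hj' := ltnW hj.
have binomSh y : binom (y + 1) (j%:Z - h%:Z)
  = binom y (j%:Z - h%:Z) + binom y (j%:Z - h.+1%:Z).
  by rewrite binomS; congr (_ + binom _ _); lia.
have [xx1|x1x] := ltP x x1; last have [x0|x0] := ltP x 0.
- have -> : (0 <= x) = false by lia.
  rewrite !andbF !muln0 !mul1r !gaugeE_left //; try lia.
  by rewrite /gauge_left -mulrBr left_polyS.
- rewrite !andbF !muln0 andbT !mulr1 !gaugeE_middle //; try lia.
  by rewrite /gauge_middle binomSh [cut b1 h1 h]cutS; ring.
rewrite !andbT !gaugeE_right //; last by lia.
rewrite /gauge_right binomSh [cut b1 h1 h]cutS [cut b2 h2 h]cutS [cut b3 h3 h]cutS.
by ring.
Qed.

End Gauge.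

(** * Comparing matrix entries with the gauge *)

Lemma sumz_finite (m j : nat) (F : int -> rat) :
    (forall q : int, j.+1%:Z < q -> F q = 0) ->
  sumz m.+1%:Z j.+1%:Z F = \sum_(q < j.+1 | (m <= q)%N) F q.+1%:Z.
Proof.
(* With the bounds in reverse order the convention sums only over [q > j.+1], where [F] vanishes. *)
move=> F0; rewrite /sumz; case: ltP => jm.
  rewrite big1 => [|i _]; last by apply: F0; lia.
  by rewrite oppr0 big_pred0 // => q; have := ltn_ord q; lia.
transitivity (\sum_(m <= q < j.+1) F q.+1%:Z); last by rewrite big_geq_mkord.
rewrite -[m in \sum_(m <= q < _) _]add0n big_addn big_mkord.
rewrite (_ : absz (j.+1%:Z + 1 - m.+1%:Z)%R = (j.+1 - m)%N); last by lia.
by apply: eq_bigr => i _; congr F; lia.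
Qed.

Lemma norm_cut b h0 h : `|cut b h0 h| = 1.
Proof. by rewrite /cut normrX normrN1 expr1n. Qed.

(** For [0 <= x] the binomial vanishes in the columns beyond [x + h], hence wherever the sign could
    act. *)
Lemma cut_binom_small b h0 h j (x : int) : 0 <= x -> (0 < b)%N ==> (x + h%:Z < h0%:Z) ->
  cut b h0 j * binom x (j%:Z - h%:Z) = binom x (j%:Z - h%:Z).
Proof.
move=> x0; rewrite /cut; case: b => [|b] /=; first by rewrite mul1r.
move=> xh0; have [jh|hj] := ltnP j h0; first by rewrite muln0 mul1r.
by rewrite binom_small ?mulr0 //; lia.
Qed.

Lemma cut_binom_const b h0 h j (x : int) : (h0 <= h)%N ->
  cut b h0 j * binom x (j%:Z - h%:Z) = cut b h0 h * binom x (j%:Z - h%:Z).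
Proof.
move=> h0h; have [jh|hj] := ltnP j h; first by rewrite binom_neg ?mulr0 //; lia.
by rewrite /cut h0h (leq_trans h0h hj).
Qed.

Lemma left_polyE b1 h1 (x1 x : int) h j :
    (0 < b1)%N ==> (0 <= x - x1) && (x - x1 + h%:Z < h1%:Z) ->
  left_poly b1 h1 x1 h x j = binom x (j%:Z - h%:Z).
Proof.
rewrite /left_poly; case: b1 => [_|b1 /= /andP[xx1 xh1]].
  by rewrite subrr mul0r addr0.
rewrite big1 ?mulr0 ?addr0 // => q h1q.
by rewrite binom_small ?mul0r //; lia.
Qed.

Lemma gauge_middle_row b1 b3 h1 h3 h (x : int) j :
  cut b3 h3 j * binom x (j%:Z - h%:Z) = cut b1 h1 h * gauge_middle b1 b3 h1 h3 h x j.
Proof. by rewrite /gauge_middle -mulrA mulrA cut_sqr mul1r. Qed.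

Lemma gauge_right_row b1 b2 b3 h1 h2 h3 h (x : int) j :
  cut b2 h2 j * binom x (j%:Z - h%:Z) =
  cut b1 h1 h * cut b2 h2 h * cut b3 h3 h * gauge_right b1 b2 b3 h1 h2 h3 h x j.
Proof.
rewrite /gauge_right -[_ * cut b2 h2 j * _]mulrA [RHS]mulrA; set e := _ * cut b3 h3 h.
have -> : e * e = 1 by rewrite /e mulrACA [X in X * _]mulrACA !cut_sqr !mulr1.
by rewrite mul1r.
Qed.

Section RowMatching.
Variables (n : nat) (G : nat -> nat -> nat -> rat).

(** Agreement of rows up to factors of absolute value 1 is enough for the absolute value of the
    determinant. *)
Definition row_match m (A : 'M[rat]_(m, n)) (us : seq (nat * nat)) :=
  size us = m /\ forall i : 'I_m, exists2 r : rat, `|r| = 1 &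
    forall j : 'I_n, A i j = r * cell_row G 0 (nth (0, 0)%N us i) j.

Lemma row_match_col_mx m1 m2 (A : 'M_(m1, n)) (B : 'M_(m2, n)) us vs :
  row_match A us -> row_match B vs -> row_match (col_mx A B) (us ++ vs).
Proof.
move=> [us_m1 Aus] [vs_m2 Bvs]; split; first by rewrite size_cat us_m1 vs_m2.
move=> i; rewrite -(splitK i); case: (split i) => k /=.
  have [r r1 Ar] := Aus k; exists r => // j.
  by rewrite col_mxEu nth_cat us_m1 ltn_ord.
have [r r1 Br] := Bvs k; exists r => // j.
by rewrite col_mxEd nth_cat us_m1 ltnNge leq_addr /= addKn.
Qed.

Lemma row_match_block m h p (entry : int -> int -> rat) :
    (forall i : nat, (i < m)%N -> exists2 r : rat, `|r| = 1 &
       forall j : nat, entry i.+1%:Z j.+1%:Z = r * G h (p + i) j) ->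
  row_match (block m n entry) (triangle_cells (h, p, m)).
Proof.
move=> entryE; split=> [|i]; first by rewrite size_map size_iota.
have [r r1 rE] := entryE i (ltn_ord i); exists r => // j.
by rewrite mxE rE (nth_map 0%N) ?size_iota // nth_iota.
Qed.

End RowMatching.

Lemma row_match_det n (G : nat -> nat -> nat -> rat) (A : 'M_n) us :
  row_match G A us -> `|\det A| = `|cdet G n 0 us|.
Proof.
move=> [us_n Aus].
have /fin_all_exists[r rP] : forall i : 'I_n, exists r : rat, `|r| = 1 /\
    forall j : 'I_n, A i j = r * cell_row G 0 (nth (0, 0)%N us i) j.
  by move=> i; have [r r1 rE] := Aus i; exists r.
have -> : A = diag_mx (\row_i r i) *m rows_mx n (map (cell_row G 0) us).
  apply/matrixP => i j; rewrite mul_diag_mx !mxE (rP i).2.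
  by rewrite (nth_map (0, 0)%N) // us_n.
rewrite det_mulmx det_diag normrM normr_prod big1 ?mul1r // => i _.
by rewrite mxE (rP i).1.
Qed.

Lemma up_triangle0 h p : up_triangle 0 h p = fset0.
Proof. by apply/fsetP => t; rewrite mem_trapezoid_at inE; lia. Qed.

Lemma up_triangle_sub b h p N L : (0 < b)%N ->
  (up_triangle b h p `<=` trapezoid N L)%fset -> 0 <= h /\ 1 <= p.
Proof.
move=> b0 /fsubsetP/(_ (true, h, p)); rewrite !mem_trapezoid_at /= => /(_ _)/and4P[|].
  by lia.
by move=> *; lia.
Qed.

(** * The region with a core and three satellites *)

Section Satellites.
Variables n1 n2 n3 a b1 b2 b3 k1 k2 : nat.
Hypothesis a_even : ~~ odd a.
Hypothesis S_def : S_defined n1 n2 n3 a b1 b2 b3 k1 k2 k2.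

Let N := (n2 + (n1 + (b3 + (a + (b1 + b2)))))%N.
Let h1 := (n3 + a./2 + b3 + k1)%N.
Let h2 := (n3 + a./2 + b3 + k2)%N.
Let h3 := (n3 - 2 * k2)%N.
(** The common left end of the satellites of sides [b2] and [b3], where the cut [x = 0] lies; [x1]
    is [p1 - c] without truncation. *)
Let c := (n1 + a./2 + b1 + k2 + 1)%N.
Let p1 := (n1 + 1 - 2 * k1)%N.
Let start := (n2 + n3 + a + b1 + b2 + b3 + 1)%N.
Let x1 : int := - (2 * k1 + a./2 + b1 + k2)%N%:Z.

(* In the truncated differences h3 and p1 the truncation is effective only if the
   hole is empty ([satellite_bounds]). *)
Definition satellite_holes : seq (nat * nat * nat) :=
  [:: (0, 1, n2); (0, start, n1); (h3, c, b3); (n3 + b3, n1 + b1 + 1, a);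
      (h1, p1, b1); (h2, c, b2)]%N.

Let a_half : a = (a./2 + a./2)%N.
Proof. by rewrite addnn even_halfK. Qed.

Lemma S_trapezoidE : S_trapezoid n1 n2 n3 a b1 b2 b3 = trapezoid N (N + n3).
Proof. by rewrite /S_trapezoid /N; congr trapezoid; lia. Qed.

Lemma satellite_bounds : ((0 < b3) ==> (2 * k2 <= n3))%N /\ ((0 < b1) ==> (2 * k1 <= n1))%N.
Proof.
case/andP: S_def; rewrite /S_holes S_trapezoidE /=.
case/and5P=> _ _ s3 _ /and3P[s1 _ _] _; split; apply/implyP => b_gt0.
  by have [] := up_triangle_sub b_gt0 s3; lia.
by have [] := up_triangle_sub b_gt0 s1; lia.
Qed.

Lemma S_holesE :
  S_holes n1 n2 n3 a b1 b2 b3 k1 k2 k2 = [seq triangle_at t | t <- satellite_holes].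
Proof.
have [k2n3 k1n1] := satellite_bounds.
rewrite /S_holes /satellite_holes /triangle_at /=.
congr [:: _; _; _; _; _; _]; try (by congr up_triangle; rewrite /start /h2 /c; lia).
  case: (b3) k2n3 => [|b] /= k2n3; first by rewrite !up_triangle0.
  by congr up_triangle; rewrite /h3 /c; lia.
case: (b1) k1n1 => [|b] /= k1n1; first by rewrite !up_triangle0.
by congr up_triangle; rewrite /h1 /p1; lia.
Qed.

Lemma holes_trapezoid :
  all (fun t => triangle_at t `<=` trapezoid N (N + n3))%fset satellite_holes.
Proof. by case/andP: S_def; rewrite S_holesE S_trapezoidE all_map. Qed.

Lemma holes_disjoint :
  pairwise (fun t u => [disjoint triangle_at t & triangle_at u])%fset satellite_holes.
Proof. by case/andP: S_def; rewrite S_holesE pairwise_map. Qed.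

(** Among the up-pointing units of the trapezoid, those with [h + p <= n2] form the left corner
    triangle and those from position [start] on the right one. The bounds serve to locate the rows
    of the first two blocks relative to the cuts. *)
Lemma hole_corner h p b : (h, p, b) \in satellite_holes -> (0 < b)%N ->
    (forall t, t \in [:: (0, 1, n2); (0, start, n1)]%N ->
      ~~ in_triangle t true h p) ->
  (n2 < h + p)%N /\ (p < start)%N.
Proof.
move=> hole b_gt0 corner.
have hp_in : in_trapezoid N (N + n3) true h p.
  by apply: (in_triangle_in_trapezoid holes_trapezoid hole); rewrite /in_triangle; lia.
have hpb_in : in_trapezoid N (N + n3) true h (p + b.-1).
  by apply: (in_triangle_in_trapezoid holes_trapezoid hole); rewrite /in_triangle; lia.
have := corner (0, 1, n2)%N; have := corner (0, start, n1)%N.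
rewrite !inE !eqxx orbT /= => /(_ isT) c1 /(_ isT) c2.
move: hp_in hpb_in c1 c2; rewrite /in_trapezoid /start /N; lia.
Qed.

Lemma hole_corner_bounds i : (2 <= i < 6)%N ->
  let: (h, p, b) := nth (0, 0, 0)%N satellite_holes i in
  (0 < b)%N ==> (n2 < h + p)%N && (p < start)%N.
Proof.
move=> /andP[i2 i6]; case e : (nth _ _ _) => [[h p] b]; apply/implyP => b0.
apply/andP; apply: (@hole_corner h p b) => //.
  by rewrite -e mem_nth.
have disj k : (k < 2)%N -> ~~ in_triangle (nth (0, 0, 0)%N satellite_holes k) true h p.
  move=> k_lt2; have h_in : in_triangle (h, p, b) true h p.
    by rewrite /in_triangle; lia.
  apply: contraL h_in; apply: disjoint_triangle_at.
  rewrite -e; have /(pairwiseP (0, 0, 0)%N) dis := holes_disjoint.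
  apply: (dis k i) => //; last by apply: leq_trans k_lt2 i2.
  by rewrite inE; apply: leq_trans k_lt2 _.
by move=> t; rewrite !inE => /orP[]/eqP->; [apply: (disj 0%N)|apply: (disj 1%N)].
Qed.

Lemma corner1 : (0 < b1)%N ==> (n2 < h1 + p1)%N && (p1 < start)%N.
Proof. exact: (@hole_corner_bounds 4). Qed.

Lemma corner2 : (0 < b2)%N ==> (n2 < h2 + c)%N && (c < start)%N.
Proof. exact: (@hole_corner_bounds 5). Qed.

Lemma corner3 : (0 < b3)%N ==> (n2 < h3 + c)%N && (c < start)%N.
Proof. exact: (@hole_corner_bounds 2). Qed.

Definition S_gauge (h p j : nat) : rat := gauge b1 b2 b3 h1 h2 h3 x1 h (p%:Z - c%:Z) j.

Let x1_le0 : x1 <= 0. Proof. by rewrite /x1; lia. Qed.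

(** The corner triangles, based in row 0, never occur in row [h.+1], and the core of even side adds
    an even exponent; the satellites account for the three signs of [gauge_diff]. *)
Lemma gauged_holes : gauged satellite_holes 0 S_gauge.
Proof.
move=> h p j _ hj; have [_ k1n1] := satellite_bounds.
rewrite /S_gauge (_ : p.+1%:Z - c%:Z = p%:Z - c%:Z + 1); last by lia.
rewrite gauge_diff //; congr (_ * _).
rewrite -!exprD /hole_sign !big_cons big_nil /= addn0.
have -> : (0 <= p%:Z - c%:Z) = (c <= p)%N by lia.
have -> : (b1 * ((h1 == h.+1) && (x1 <= p%:Z - c%:Z)%R) =
           if h1 == h.+1 then b1 * (p1 <= p) else 0)%N.
  case: eqP => _; last by rewrite muln0.
  case: (b1 =P 0%N) => [->//|b1_n0]; congr (_ * nat_of_bool _)%N.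
  by rewrite /x1 /c /p1; lia.
have muln_if (x y : bool) m : (m * (x && y) = if x then m * y else 0)%N.
  by case: x; rewrite ?muln0.
rewrite !{}muln_if -[LHS]signr_odd -[RHS]signr_odd; congr (_ ^+ nat_of_bool _).
set e1 := (b1 * _)%N; set e2 := (b2 * _)%N; set e3 := (b3 * _)%N; set e4 := (a * _)%N.
have odd_e4 : odd e4 = false by rewrite oddM (negPf a_even).
by case: (h1 == h.+1); case: (h2 == h.+1); case: (h3 == h.+1);
  case: (n3 + b3 == h.+1)%N; rewrite /= ?addn0 ?oddD ?odd_e4;
  case: (odd e1); case: (odd e2); case: (odd e3).
Qed.

Lemma entry_sign b h (y : int) j : (0 < b)%N ==> (y == h%:Z) ->
  (-1) ^+ ((y + 1 <= j.+1%:Z)%R * b)%N = cut b h j.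
Proof.
rewrite /cut mulnC; case: b => [|b] /=; first by rewrite !mul0n.
by move=> /eqP->; congr (_ ^+ (_ * nat_of_bool _)); lia.
Qed.

(** The entry is the left formula of the gauge at every position. Up to a row sign it stays valid
    beyond a cut, because a position [p <= n2] is so close to the cut that the binomials vanish in
    the columns where a satellite would change a sign. *)
Lemma row_match_entry1 : row_match S_gauge (block n2 N (entry1 n1 n3 a b1 b3 k1 k2))
  (triangle_cells (0, 1, n2)%N).
Proof.
apply: row_match_block => i i_n2.
have [k2n3 k1n1] := satellite_bounds.
have c1 := corner1; have c2 := corner2; have c3 := corner3.
rewrite /S_gauge; set x : int := (1 + i)%N%:Z - c%:Z.
have entryE j : entry1 n1 n3 a b1 b3 k1 k2 i.+1%:Z j.+1%:Z
                = cut b3 h3 j * left_poly b1 h1 x1 0 x j.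
  rewrite /entry1 (@entry_sign _ h3) //; last by rewrite /h3; lia.
  congr (_ * (_ + _ * _)); first by congr binom; rewrite /x /c; lia.
  rewrite (_ : n3%:Z + (a./2)%:Z + b3%:Z + k1%:Z + 1 = h1.+1%:Z); last by rewrite /h1; lia.
  rewrite sumz_finite => [|q jq]; last by rewrite [X in _ * X]binom_neg ?mulr0 //; lia.
  apply: eq_bigr => q _; congr (binom _ _ * binom _ _); rewrite /x /x1 /c; lia.
have [xx1|x1x] := leP x x1.
  by exists 1; rewrite ?normr1 // => j; rewrite mul1r gaugeE_left.
(* If [b1 > 0], then [x - x1 <= n2 - p1 < h1] by [corner1]. *)
have left_simpl j : left_poly b1 h1 x1 0 x j = binom x (j%:Z - 0%:Z).
  by apply: left_polyE; move: c1; rewrite /x /x1 /c /p1 in x1x *; lia.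
have [x0|x0] := leP x 0.
  exists (cut b1 h1 0); first exact: norm_cut.
  by move=> j; rewrite entryE left_simpl gaugeE_middle ?(ltW x1x) // -gauge_middle_row.
exists (cut b1 h1 0 * cut b2 h2 0 * cut b3 h3 0);
  first by rewrite !normrM !norm_cut !mulr1.
move=> j; rewrite entryE left_simpl gaugeE_right ?(ltW x0) // -gauge_right_row.
(* Likewise [x <= n2 - c] is below [h2] if [b2 > 0], and below [h3] if [b3 > 0]. *)
rewrite !cut_binom_small ?(ltW x0) //; first by move: c2; rewrite /x; lia.
by move: c3; rewrite /x; lia.
Qed.

(** Positions from [start] on lie to the right of the left edge of every nonempty satellite. A cut
    that is not passed therefore belongs to empty satellites and carries no sign. *)
Lemma row_match_entry2 : row_match S_gauge (block n1 N (entry2 n1 n2 n3 a b2 b3 k2))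
  (triangle_cells (0, start, n1)%N).
Proof.
apply: row_match_block => i i_n1.
have [k2n3 k1n1] := satellite_bounds.
have c1 := corner1; have c2 := corner2; have c3 := corner3.
rewrite /S_gauge; set x : int := (start + i)%N%:Z - c%:Z.
have entryE j : entry2 n1 n2 n3 a b2 b3 k2 i.+1%:Z j.+1%:Z
                = cut b2 h2 j * binom x (j%:Z - 0%:Z).
  rewrite /entry2 (@entry_sign _ h2) //; last by rewrite /h2; lia.
  by congr (_ * binom _ _); rewrite /x /c /start; lia.
have [x0|x0] := leP 0 x.
  exists (cut b1 h1 0 * cut b2 h2 0 * cut b3 h3 0);
    first by rewrite !normrM !norm_cut !mulr1.
  by move=> j; rewrite entryE gaugeE_right // -gauge_right_row.
have b2_0 : b2 = 0%N by move: c2; rewrite /x in x0 *; lia.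
have b3_0 : b3 = 0%N by move: c3; rewrite /x in x0 *; lia.
have cut0 h h' : cut 0 h h' = 1 by [].
have [x1x|xx1] := leP x1 x.
  exists (cut b1 h1 0); first exact: norm_cut.
  move=> j; rewrite entryE gaugeE_middle ?(ltW x0) // -gauge_middle_row.
  by rewrite b2_0 b3_0 !cut0.
exists 1; rewrite ?normr1 // => j.
rewrite entryE gaugeE_left ?(ltW xx1) // /gauge_left left_polyE ?b2_0 ?b3_0 ?cut0 ?mul1r //.
by move: c1; rewrite /x /x1 /c /p1 in xx1 *; lia.
Qed.

Lemma row_match_entry3 : row_match S_gauge (block b3 N (entry3 n3 k2))
  (triangle_cells (h3, c, b3)).
Proof.
apply: row_match_block => i i_b3; have [k2n3 _] := satellite_bounds.
exists (cut b1 h1 h3 * cut b2 h2 h3 * cut b3 h3 h3);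
  first by rewrite !normrM !norm_cut !mulr1.
move=> j; rewrite /S_gauge (_ : (c + i)%N%:Z - c%:Z = i%:Z); last by lia.
rewrite gaugeE_right // -gauge_right_row cut_binom_small //; last by rewrite /h2 /h3; lia.
by rewrite /entry3; congr binom; rewrite /h3; lia.
Qed.

(** The base of the core may cross the cut [x = 0]. To its left the column sign of [b3] is constant
    from column [ha] on, since [h3 <= ha]; to its right the binomials vanish from column [h2] on. *)
Lemma row_match_entry4 : row_match S_gauge (block a N (entry4 n3 a b3 k2))
  (triangle_cells (n3 + b3, n1 + b1 + 1, a)%N).
Proof.
apply: row_match_block => i i_a.
rewrite /S_gauge; set x : int := (n1 + b1 + 1 + i)%N%:Z - c%:Z; set ha := (n3 + b3)%N.
have entryE j : entry4 n3 a b3 k2 i.+1%:Z j.+1%:Z = binom x (j%:Z - ha%:Z).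
  by rewrite /entry4; congr binom; rewrite /x /c /ha; lia.
have x1x : x1 <= x by rewrite /x /x1 /c; lia.
have [x0|x0] := leP x 0.
  exists (cut b1 h1 ha * cut b3 h3 ha); first by rewrite normrM !norm_cut mulr1.
  move=> j; rewrite entryE; have [jh|hj] := ltnP j ha.
    by rewrite gauge_low // binom_neg ?mulr0 //; lia.
  rewrite gaugeE_middle // /gauge_middle -[_ * cut b3 h3 j * _]mulrA.
  rewrite cut_binom_const; last by rewrite /h3 /ha; lia.
  by rewrite mulrACA cut_sqr mul1r mulrA cut_sqr mul1r.
exists (cut b1 h1 ha * cut b2 h2 ha * cut b3 h3 ha);
  first by rewrite !normrM !norm_cut !mulr1.
move=> j; rewrite entryE gaugeE_right ?(ltW x0) // -gauge_right_row.
by rewrite cut_binom_small ?(ltW x0) //; rewrite /x /c /h2 /ha; lia.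
Qed.

Lemma row_match_entry5 : row_match S_gauge (block b1 N (entry5 n3 a b1 b3 k1 k2))
  (triangle_cells (h1, p1, b1)).
Proof.
apply: row_match_block => i i_b1.
have [_ k1n1] := satellite_bounds.
rewrite /S_gauge; set x : int := (p1 + i)%N%:Z - c%:Z.
have entryE j : entry5 n3 a b1 b3 k1 k2 i.+1%:Z j.+1%:Z = binom x (j%:Z - h1%:Z).
  by rewrite /entry5; congr binom; rewrite /x /p1 /c /h1; lia.
have x1x : x1 <= x by rewrite /x /x1 /p1 /c; lia.
have x0 : x <= 0 by rewrite /x /p1 /c; lia.
exists (cut b1 h1 h1 * cut b3 h3 h1); first by rewrite normrM !norm_cut mulr1.
move=> j; rewrite entryE; have [jh|hj] := ltnP j h1.
  by rewrite gauge_low // binom_neg ?mulr0 //; lia.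
rewrite gaugeE_middle // /gauge_middle -[_ * cut b3 h3 j * _]mulrA.
rewrite cut_binom_const; last by rewrite /h3 /h1; lia.
by rewrite mulrACA cut_sqr mul1r mulrA cut_sqr mul1r.
Qed.

Lemma row_match_entry6 : row_match S_gauge (block b2 N (entry6 n3 a b3 k2))
  (triangle_cells (h2, c, b2)).
Proof.
apply: row_match_block => i i_b2.
exists (cut b2 h2 h2 * (cut b1 h1 h2 * cut b2 h2 h2 * cut b3 h3 h2)).
  by rewrite !normrM !norm_cut !mulr1.
move=> j; rewrite /S_gauge (_ : (c + i)%N%:Z - c%:Z = i%:Z); last by lia.
rewrite gaugeE_right // -mulrA -gauge_right_row cut_binom_const // mulrA cut_sqr mul1r.
by rewrite /entry6; congr binom; rewrite /h2; lia.
Qed.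

Lemma S_formula : (M (S_region n1 n2 n3 a b1 b2 b3 k1 k2 k2))%:R
  = `| \det (S_matrix n1 n2 n3 a b1 b2 b3 k1 k2) | :> rat.
Proof.
rewrite /S_region S_holesE S_trapezoidE big_map.
rewrite (@holes_formula _ _ _ (leq_addr _ _) holes_trapezoid holes_disjoint
  S_gauge (gauge_exponent b1 b3 h1 h3)).
- apply/esym/row_match_det.
  rewrite /S_matrix /cells /satellite_holes /= cats0.
  apply: row_match_col_mx; first exact: row_match_entry1.
  apply: row_match_col_mx; first exact: row_match_entry2.
  apply: row_match_col_mx; first exact: row_match_entry3.
  apply: row_match_col_mx; first exact: row_match_entry4.
  by apply: row_match_col_mx; [exact: row_match_entry5|exact: row_match_entry6].
- by move=> h p; apply: gauge_diag.
- by move=> h p j; apply: gauge_low.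
- exact: gauged_holes.
by rewrite /satellite_holes !big_cons big_nil /= /N; lia.
Qed.

End Satellites.

Theorem theorem5 (n1 n2 n3 a b1 b2 b3 k1 k2 : nat)
    (a_even : ~~ odd a)
    (S_def : S_defined n1 n2 n3 a b1 b2 b3 k1 k2 k2) :
  (M (S_region n1 n2 n3 a b1 b2 b3 k1 k2 k2))%:R
  = `| \det (S_matrix n1 n2 n3 a b1 b2 b3 k1 k2) | :> rat.
Proof. exact: S_formula. Qed.
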